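(* For every integer $q>1$, \begin{align*} (1-(-1)^q)T_{12,q}&=\pi^2(\zeta(q,1)+2\log(2)\zeta(q))-(q-1)\pi^2\zeta(q+1)+((-1)^{q+1}-1)\widetilde{t}(2)\widetilde{t}(q,1)\\ &\quad-\widetilde{t}(2)\widetilde{t}(q+1)-\widetilde{t}(q+2,1)-\widetilde{t}(q+1,2)-(-1)^q\widetilde{t}(q+3)\\ &\quad+2(1+(-1)^q)\log(2)\widetilde{t}(q+2)+2\sum_{\substack{2k_1+k_2=q+2\\ k_1,k_2\geq 1}} (k_2-1)\widetilde{t}(2k_1)\zeta(k_2+1)\\ &\quad+4\log(2)\sum_{\substack{2k_1+k_2=q+1\\ k_1,k_2\geq 1}} k_2\, \widetilde{t}(2k_1)\zeta(k_2+1)-2\sum_{\substack{2k_1+k_2+k_3=q+1\\ k_1,k_2\geq 1}} k_3\, \widetilde{t}(2k_1)\zeta(k_2+1)\zeta(k_3+1). \end{align*}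
   Context: Let $h_n^{(p)}=\sum_{k=1}^n (k-1/2)^{-p}$ for $n\ge0$, $h_n=h_n^{(1)}$. For $q\ge2$, $T_{12,q}=\sum_{n=1}^\infty \frac{h_{n-1}h_{n-1}^{(2)}}{(n-1/2)^q}$. For positive integers $s_1,\dots,s_k$ with $s_1>1$, $\widetilde{t}(s_1,\dots,s_k)=\sum_{n_1>\cdots>n_k\ge1}\prod_j (n_j-1/2)^{-s_j}$, and $\zeta(s_1,\dots,s_k)=\sum_{n_1>\cdots>n_k\ge1}\prod_j n_j^{-s_j}$ (multiple zeta values); $\zeta(s)$ is the Riemann zeta function. In the last sum $k_3$ ranges over positive integers. *)

(* Defs.v *)
From mathcomp Require Import all_boot all_order all_algebra.
From mathcomp Require Import all_classical all_reals all_analysis.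

Set Implicit Arguments.
Unset Strict Implicit.
Unset Printing Implicit Defensive.

Import Order.TTheory GRing.Theory Num.Theory.
Import numFieldNormedType.Exports.

Local Open Scope ring_scope.

(* [hodd p n] is h_n^{(p)}: the order p comes first. *)
Definition hodd {R : realType} (p n : nat) : R :=
  \sum_(1 <= k < n.+1) (k%:R - 2^-1) ^- p.

(* sum over N > n_1 > ... > n_k >= 1 of \prod_j (n_j - a)^{-s_j}; the inner
   call at N := n enforces n_2 < n_1 = n, and the empty index gives 1. *)
Fixpoint mharm {R : realType} (a : R) (s : seq nat) (N : nat) : R :=
  if s is s1 :: s' then \sum_(1 <= n < N) (n%:R - a) ^- s1 * mharm a s' n
  else 1.

(* In both cases s_1 is the exponent of the largest summation index. The value
   is only meaningful when the entries are positive and the first one is > 1;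
   on a divergent sequence [limn] returns a default value. *)
Definition mzeta {R : realType} (s : seq nat) : R := limn (mharm 0 s).

Definition mtt {R : realType} (s : seq nat) : R := limn (mharm 2^-1 s).

Definition T12 {R : realType} (q : nat) : R :=
  \big[+%R/0]_(1 <= n <oo) (hodd 1 n.-1 * hodd 2 n.-1 / (n%:R - 2^-1) ^+ q).

(* Main.v *)
Require Import Defs.
From mathcomp Require Import all_boot all_order all_algebra.
From mathcomp Require Import all_classical all_reals all_analysis.
From mathcomp Require Import ring lra zify.

Set Implicit Arguments.
Unset Strict Implicit.
Unset Printing Implicit Defensive.

Import Order.TTheory GRing.Theory Num.Theory.
Import numFieldNormedType.Exports.

Local Open Scope ring_scope.

(* Put x_n = n - 1/2 and consider the kernel
     pi tan(pi s) (psi(-s) + gamma + 2 log 2) psi'(-s) / s^q,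
   whose residues sum to zero. At s = +-x_n they produce T_{12,q} and the
   double t-values, at s = n the values zeta(q,1), zeta(q) and zeta(q+1), and at
   s = 0 the sums over k_1, k_2, k_3. To stay elementary the three factors are
   replaced by their partial sums with N poles: the residue theorem then becomes
   an explicit partial fraction identity, evaluated at each s = +-x_n and summed
   over n <= N. All the truncated sums are differences of (half-integer) harmonic
   numbers, so the limit N -> oo follows by dominated convergence for series,
   with majorant a multiple of h_n / x_n^2. The constants enter through
   h_N - H_N -> 2 log 2 and sum_n x_n^-2 = pi^2 / 2, the latter by iterating
   4 / sin^2(2y) = 1 / sin^2 y + 1 / sin^2(pi/2 - y). *)

(** * Partial fractions *)

Section partial_fractions.
Variable F : numFieldType.
Implicit Types (m a k L : F) (q : nat).

(** Iterating [rS] peels off the Taylor coefficients [c i] of [r 0] at 0 one by one. After division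
    by [a ^+ q], what is left besides the pole at 0 is [r q]; in the applications it collects the
    polar parts at the nonzero poles. *)
Lemma taylor_remainder a (c r : nat -> F) (a0 : a != 0)
    (rS : forall q, r q = c q + a * r q.+1) q :
  r 0%N * a ^- q = \sum_(i < q) c i * a ^- (q - i) + r q.
Proof.
elim: q => [|q IH]; first by rewrite big_ord0 expr0 invr1 mulr1 add0r.
rewrite big_ord_recr /= subSn// subnn expr1 exprSr invfM mulrA IH (rS q).
rewrite mulrDl mulr_suml -addrA; congr (_ + _).
  by apply: eq_bigr => i _; rewrite subSn ?(ltnW (ltn_ord i))// exprSr invfM mulrA.
by field.
Qed.

(* [polei_rem m a q] is the sum of the polar parts at [s = m] of
   [(m - s) ^- i * s ^- q], evaluated at [s = a]. *)
Definition pole1_rem m a q := m ^- q * (m - a)^-1.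
Definition pole2_rem m a q := q%:R * m ^- q.+1 * (m - a)^-1 + m ^- q * (m - a) ^- 2.
Definition pole3_rem m a q :=
  q%:R * q.+1%:R / 2 * m ^- q.+2 * (m - a)^-1 + q%:R * m ^- q.+1 * (m - a) ^- 2
  + m ^- q * (m - a) ^- 3.

(** This recurrence and the next two supply the hypothesis of [taylor_remainder]: the isolated term
    is the coefficient of [a ^+ q] in [(m - a) ^- i], for [i] = 1, 2, 3. *)
Lemma pole1_remS m a q : m != 0 -> m - a != 0 ->
  pole1_rem m a q = m ^- q.+1 + a * pole1_rem m a q.+1.
Proof.
move=> m0 ma0; rewrite /pole1_rem exprS.
have mq : m ^+ q != 0 by rewrite expf_neq0.
by field; apply/and3P.
Qed.

Lemma pole2_remS m a q : m != 0 -> m - a != 0 ->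
  pole2_rem m a q = q.+1%:R * m ^- q.+2 + a * pole2_rem m a q.+1.
Proof.
move=> m0 ma0; rewrite /pole2_rem !exprS -natr1.
have mq : m ^+ q != 0 by rewrite expf_neq0.
by field; apply/and3P.
Qed.

Lemma pole3_remS m a q : m != 0 -> m - a != 0 ->
  pole3_rem m a q = q.+1%:R * q.+2%:R / 2 * m ^- q.+3 + a * pole3_rem m a q.+1.
Proof.
move=> m0 ma0; rewrite /pole3_rem !exprS -!natr1.
have mq : m ^+ q != 0 by rewrite expf_neq0.
by field; apply/and3P.
Qed.

(* The diagonal terms rely on [0^-1 = 0]. *)
Lemma pole12_split k m a : k - a != 0 -> m - a != 0 ->
  (k - a)^-1 * (m - a) ^- 2 =
  (k == m)%:R * (m - a) ^- 3 + (k - m)^-1 * (m - a) ^- 2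
  - (k - m) ^- 2 * ((m - a)^-1 - (k - a)^-1).
Proof.
move=> ka ma; have [->|km] := eqVneq k m.
  by rewrite subrr expr0n /= invr0; field.
have km0 : k - m != 0 by rewrite subr_eq0.
by rewrite /=; field; apply/and3P.
Qed.

(** This compares the coefficients of [a ^+ n] in [pole12_split]; the left side is the Cauchy
    product of the two power series. In the induction, the terms after [j = 0] form [k^-1] times the
    previous sum. *)
Lemma pole12_coef k m n : k != 0 -> m != 0 ->
  \sum_(j < n.+1) k ^- j.+1 * ((n - j).+1%:R * m ^- (n - j).+2) =
  (k == m)%:R * (n.+1%:R * n.+2%:R / 2 * m ^- n.+3)
  + (k - m)^-1 * (n.+1%:R * m ^- n.+2)
  - (k - m) ^- 2 * (m ^- n.+1 - k ^- n.+1).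
Proof.
move=> k0 m0; elim: n => [|n IH].
  rewrite big_ord_recr big_ord0 /= add0r subnn.
  have [->|km] := eqVneq k m; first by rewrite !subrr expr0n /= invr0; field.
  have km0 : k - m != 0 by rewrite subr_eq0.
  by rewrite /=; field; apply/and3P.
rewrite big_ord_recl /= subn0.
under eq_bigr => j _ do rewrite /bump /= add1n subSS exprS invfM -mulrA.
rewrite -mulr_sumr IH; have mn : m ^+ n != 0 by rewrite expf_neq0.
have kn : k ^+ n != 0 by rewrite expf_neq0.
rewrite !exprS -!natr1.
have [E|km] := eqVneq k m.
  by rewrite -E in mn m0 *; rewrite !subrr !mul0r /= !invr0; field; apply/andP.
have km0 : k - m != 0 by rewrite subr_eq0.
by rewrite /=; field; apply/and5P.
Qed.

End partial_fractions.

Section pole_sums.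
Variables (F : numFieldType) (s : seq F).
Hypothesis s_uniq : uniq s.

Let sum_diag (f : F -> F) :
  \sum_(m <- s) \sum_(k <- s) (k == m)%:R * f m = \sum_(m <- s) f m.
Proof.
rewrite big_seq [RHS]big_seq; apply: eq_bigr => m ms.
rewrite (bigD1_seq m)//= eqxx mul1r big1 ?addr0// => k /negPf ->.
by rewrite mul0r.
Qed.

(** Exchanging [m] and [k] changes the sign of the summand, so the sum is its own opposite. This
    removes the last terms of [pole12_split] and [pole12_coef] after summation over all pairs. *)
Let sum_antisym (f : F -> F) :
  \sum_(m <- s) \sum_(k <- s) (k - m) ^- 2 * (f m - f k) = 0.
Proof.
set X := LHS; have XN : X = - X.
  rewrite {1}/X exchange_big /= -sumrN; apply: eq_bigr => m _.
  rewrite -sumrN; apply: eq_bigr => k _.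
  by rewrite -mulrN opprB -(opprB k m) sqrrN.
by apply/eqP; have := addrN X; rewrite {1}XN => /eqP; rewrite -opprD oppr_eq0 -mulr2n mulrn_eq0.
Qed.

Let Vp a p := \sum_(k <- s) (k - a) ^- p.
Let z p := \sum_(k <- s) k ^- p.
(** At a pole [m] of [s] the diagonal term is [0^-1 = 0], so [V m] is then the constant term of the
    sum at [m], with its polar part removed. *)
Let V m := \sum_(k <- s) (k - m)^-1.

Lemma sum_pole_mul a : {in s, forall k, k - a != 0} ->
  V a * Vp a 2 = \sum_(m <- s) ((m - a) ^- 3 + V m * (m - a) ^- 2).
Proof.
move=> sa; rewrite mulr_sumr.
transitivity (\sum_(m <- s) \sum_(k <- s)
   ((k == m)%:R * (m - a) ^- 3 + (k - m)^-1 * (m - a) ^- 2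
  - (k - m) ^- 2 * ((m - a)^-1 - (k - a)^-1))).
  rewrite big_seq [RHS]big_seq; apply: eq_bigr => m ms; rewrite mulr_suml.
  rewrite big_seq [RHS]big_seq; apply: eq_bigr => k ks.
  by rewrite pole12_split ?sa.
under eq_bigr => m _ do rewrite big_split big_split /= sumrN.
rewrite big_split big_split /= sumrN sum_antisym subr0 sum_diag -big_split /=.
by apply: eq_bigr => m _; rewrite /V mulr_suml.
Qed.

Lemma sum_pole_coef n : {in s, forall k : F, k != 0} ->
  \sum_(j < n.+1) z j.+1 * ((n - j).+1%:R * z (n - j).+2) =
  \sum_(m <- s) (n.+1%:R * n.+2%:R / 2 * m ^- n.+3 + V m * (n.+1%:R * m ^- n.+2)).
Proof.
move=> s0.
transitivity (\sum_(m <- s) \sum_(k <- s) \sum_(j < n.+1)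
    k ^- j.+1 * ((n - j).+1%:R * m ^- (n - j).+2)).
  under [RHS]eq_bigr => m _ do rewrite exchange_big /=.
  rewrite [RHS]exchange_big /=; apply: eq_bigr => j _.
  rewrite mulr_sumr mulr_sumr; apply: eq_bigr => m _.
  by rewrite mulr_suml.
transitivity (\sum_(m <- s) \sum_(k <- s)
  ((k == m)%:R * (n.+1%:R * n.+2%:R / 2 * m ^- n.+3)
  + (k - m)^-1 * (n.+1%:R * m ^- n.+2)
  - (k - m) ^- 2 * (m ^- n.+1 - k ^- n.+1))).
  rewrite big_seq [RHS]big_seq; apply: eq_bigr => m ms.
  rewrite big_seq [RHS]big_seq; apply: eq_bigr => k ks.
  by rewrite pole12_coef ?s0.
under eq_bigr => m _ do rewrite big_split big_split /= sumrN.
rewrite big_split big_split /= sumrN sum_antisym subr0 sum_diag -big_split /=.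
by apply: eq_bigr => m _; rewrite /V mulr_suml.
Qed.

Variables (a L : F).
Hypotheses (a0 : a != 0) (s0 : {in s, forall k : F, k != 0})
  (sa : {in s, forall k, k - a != 0}).

(** The exponent is a successor so that the constant [L] is absorbed by the coefficient at [i = 0]
    and the remainder consists of polar parts only. *)
Lemma sum_pole1_expansion q :
  (L - V a) * a ^- q.+1 =
  \sum_(i < q.+1) (L *+ (i == 0 :> nat) - z i.+1) * a ^- (q.+1 - i)
  - \sum_(m <- s) pole1_rem m a q.+1.
Proof.
pose r q := L *+ (q == 0%N) - \sum_(m <- s) pole1_rem m a q.
have -> : L - V a = r 0%N.
  rewrite /r mulr1n; congr (_ - _); apply: eq_bigr => m _.
  by rewrite /pole1_rem expr0 invr1 mul1r.
have -> : - \sum_(m <- s) pole1_rem m a q.+1 = r q.+1 by rewrite /r mulr0n sub0r.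
apply: (@taylor_remainder _ a (fun i => L *+ (i == 0%N) - z i.+1)) => // i.
rewrite /r mulr0n sub0r -addrA mulrN mulr_sumr -opprD; congr (_ - _).
rewrite -big_split /= big_seq [RHS]big_seq; apply: eq_bigr => m ms.
by rewrite [LHS](pole1_remS _ (s0 ms) (sa ms)).
Qed.

Lemma sum_pole2_expansion q :
  Vp a 2 * a ^- q =
  \sum_(i < q) (i.+1%:R * z i.+2) * a ^- (q - i) + \sum_(m <- s) pole2_rem m a q.
Proof.
pose r q := \sum_(m <- s) pole2_rem m a q.
rewrite -(@taylor_remainder _ a (fun i => i.+1%:R * z i.+2) r a0).
  congr (_ * _); apply: eq_bigr => m _.
  by rewrite /pole2_rem expr0 invr1 mul1r !mul0r add0r.
move=> i; rewrite /r !mulr_sumr.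
rewrite -big_split /= big_seq [RHS]big_seq; apply: eq_bigr => m ms.
by rewrite [LHS](pole2_remS _ (s0 ms) (sa ms)).
Qed.

(** By [sum_pole_mul] the product is already a sum of double and triple poles, and by
    [sum_pole_coef] its Taylor coefficients are those of the factors, convolved. The recurrences for
    the double and triple poles then apply pole by pole. *)
Lemma sum_pole12_expansion q :
  (L - V a) * Vp a 2 * a ^- q =
  \sum_(i < q) (L * (i.+1%:R * z i.+2)
     - \sum_(j < i.+1) z j.+1 * ((i - j).+1%:R * z (i - j).+2)) * a ^- (q - i)
  + \sum_(m <- s) ((L - V m) * pole2_rem m a q - pole3_rem m a q).
Proof.
pose r q := \sum_(m <- s) ((L - V m) * pole2_rem m a q - pole3_rem m a q).
rewrite -(@taylor_remainder _ a (fun i => L * (i.+1%:R * z i.+2)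
     - \sum_(j < i.+1) z j.+1 * ((i - j).+1%:R * z (i - j).+2)) r a0).
  congr (_ * _); rewrite mulrBl sum_pole_mul// mulr_sumr -sumrB.
  apply: eq_bigr => m _; rewrite /pole2_rem /pole3_rem expr0 invr1.
  by ring.
move=> i; rewrite /r sum_pole_coef// !mulr_sumr -sumrB -big_split /=.
rewrite big_seq [RHS]big_seq; apply: eq_bigr => m ms.
rewrite (pole2_remS i (s0 ms) (sa ms)) (pole3_remS i (s0 ms) (sa ms)).
by ring.
Qed.

End pole_sums.

(** * Harmonic numbers with offset [c]: ordinary for [c = 0], half-integer for [c = 2^-1] *)

Definition ipsum {R : realType} (c : R) (p N : nat) : R :=
  \sum_(1 <= k < N.+1) (k%:R - c) ^- p.

Section shifted_sums.
Variable R : realType.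
Implicit Types (c : R) (p N j m n : nat).

Local Notation h := (@ipsum R 2^-1).
Local Notation H := (@ipsum R 0).

Lemma ipsum0 c p : ipsum c p 0 = 0.
Proof. by rewrite /ipsum big_geq. Qed.

Lemma ipsumS c p N : ipsum c p N.+1 = ipsum c p N + (N.+1%:R - c) ^- p.
Proof. by rewrite /ipsum big_nat_recr. Qed.

Lemma expVN (x : R) p : (- x) ^- p = (-1) ^+ p * x ^- p.
Proof. by rewrite -!exprVn invrN [LHS]exprNn. Qed.

Lemma ipsum_shiftD c p N j :
  \sum_(1 <= n < N.+1) ((n + j)%:R - c) ^- p = ipsum c p (N + j) - ipsum c p j.
Proof.
elim: N => [|N IH]; first by rewrite big_geq// add0n subrr.
by rewrite big_nat_recr//= IH addSn ipsumS addrAC.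
Qed.

(** The differences run through consecutive half-integers. Those with [n <= j] are negative and,
    read backwards, give the sign [(-1) ^+ p] and [h p j]; the others give [h p (N - j)]. *)
Lemma ipsum_shiftB p N j : (j <= N)%N ->
  \sum_(1 <= n < N.+1) (n%:R - (j%:R + 2^-1)) ^- p = h p (N - j) + (-1) ^+ p * h p j.
Proof.
move=> jN; rewrite (@big_cat_nat _ _ _ j.+1)//= addrC; congr (_ + _).
  rewrite -{1}[j.+1]add1n big_addn subSn// /ipsum; apply: eq_bigr => n _.
  by rewrite natrD opprD addrA addrK.
rewrite big_nat_rev /= /ipsum mulr_sumr; apply: eq_big_nat => n /andP[n1 nj].
rewrite -expVN opprB; congr (_ ^- _).
have -> : (1 + j.+1 - n.+1 = j.+1 - n)%N by lia.
by rewrite natrB ?(ltnW nj)// -natr1; field.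
Qed.

(** The term [n = j.+1] is [0^-1 = 0]; the terms on its two sides are reciprocals of positive and of
    negative integers. *)
Lemma ipsum_shift_int N j : (j < N)%N ->
  \sum_(1 <= n < N.+1) (n%:R - j.+1%:R)^-1 = H 1 (N - j.+1) - H 1 j.
Proof.
move=> jN; rewrite (@big_cat_nat _ _ _ j.+1)//=; last by lia.
rewrite [X in _ + X]big_ltn; last by lia.
rewrite subrr invr0 add0r addrC; congr (_ + _).
  rewrite -{1}[j.+2]add1n big_addn subSn// /ipsum; apply: eq_bigr => n _.
  by rewrite natrD addrK subr0 expr1.
rewrite big_nat_rev /= /ipsum -sumrN; apply: eq_big_nat => n /andP[n1 nj].
have -> : (1 + j.+1 - n.+1 = j.+1 - n)%N by lia.
by rewrite natrB ?(ltnW nj)// subr0 expr1 -invrN; congr (_^-1); ring.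
Qed.

Lemma half_int_neq0 (n m : nat) : (n%:R - (m%:R + 2^-1) : R) != 0.
Proof.
apply/eqP => /(congr1 ( *%R 2)); rewrite mulr0 mulrBr mulrDr mulfV// => /eqP.
rewrite subr_eq0 -!natrM -(natrD _ _ 1) eqr_nat => /eqP; lia.
Qed.

Lemma half_int_gt0 n : 0 < n.+1%:R - 2^-1 :> R.
Proof. by rewrite -natr1; have := ler0n R n; lra. Qed.

End shifted_sums.

(** * The finite form of the residue theorem *)

Section finite_identity.
Variables (R : realType) (L : R) (q N : nat).

Local Notation h := (@ipsum R 2^-1).
Local Notation H := (@ipsum R 0).

Let x n : R := n%:R - 2^-1.

(* The values of the truncated kernel (without its factor pi tan(pi s)) at
   [s = x n] and [s = - x n], added up; see [kernel_half_int]. *)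
Definition half_term n :=
  ((L + H 1 N - h 1 (N - n.-1) + h 1 n) * (h 2 (N - n.-1) + h 2 n)
   + (-1) ^+ q * (L + H 1 N - h 1 (N + n) + h 1 n.-1) * (h 2 (N + n) - h 2 n.-1))
  * (n%:R - 2^-1) ^- q.

Local Notation S p m := (h p (N + m) + (-1) ^+ p * h p (N - m)).

(* The polar parts at [s = m], summed over all the points [x n] and [- x n]. *)
Definition int_term m :=
  (L + H 1 N - H 1 (N - m) + H 1 m.-1)
     * (q%:R * m%:R ^- q.+1 * S 1 m + m%:R ^- q * S 2 m)
  - (q%:R * q.+1%:R / 2 * m%:R ^- q.+2 * S 1 m + q%:R * m%:R ^- q.+1 * S 2 m
     + m%:R ^- q * S 3 m)
  + (q%:R * m%:R ^- q.+2 * S 1 m + m%:R ^- q.+1 * S 2 m).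

Local Notation P j := ((1 + (-1) ^+ j) * h j N).

(* Taylor coefficients at 0 of the product of the two truncated digamma factors,
   respectively of the first one. *)
Definition coef12 i :=
  L * (i.+1%:R * H i.+2 N) - \sum_(j < i) H j.+2 N * ((i - j)%:R * H (i - j).+1 N).

Definition coef1 i := if i is 0 then L else - H i.+1 N.

Let s : seq R := [seq k%:R | k <- index_iota 1 N.+1].

(** The first factor truncates psi(-a) + gamma + 2 log 2, with [L] in the place of 2 log 2, and the
    second truncates psi'(-a). The separate powers of [a] are the terms [k = 0] of these series. *)
Let kernel a := (L + H 1 N - \sum_(k <- s) (k - a)^-1 + a^-1)
  * (\sum_(k <- s) (k - a) ^- 2 + a ^- 2) * a ^- q.

Let s_uniq : uniq s.
Proof. by rewrite map_inj_uniq ?iota_uniq//; exact: mulrIn (oner_neq0 _). Qed.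

Let s0 : {in s, forall k : R, k != 0}.
Proof.
by move=> k /mapP[n]; rewrite mem_index_iota => /andP[n1 _] ->; rewrite pnatr_eq0 -lt0n.
Qed.

Let sumH p : \sum_(k <- s) k ^- p = H p N.
Proof. by rewrite /s big_map /ipsum; apply: eq_bigr => k _; rewrite subr0. Qed.

Let kernel_half_int n : (0 < n <= N)%N ->
  kernel (x n) + kernel (- x n) = half_term n.
Proof.
case: n => // n /= nN; rewrite /kernel /half_term /s.
(* Adding the terms [a^-1] and [a ^- 2] of the kernel turns [h p n] into [h p n.+1] at [x n.+1], and
   [h p n.+1] into [h p n] at [- x n.+1]. *)
have E1 p : \sum_(k <- s) (k - x n.+1) ^- p = h p (N - n) + (-1) ^+ p * h p n.
  rewrite /s big_map -ipsum_shiftB//; last exact: ltnW.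
  by apply: eq_bigr => k _; congr (_ ^- _); rewrite /x -natr1; field.
have E2 p : \sum_(k <- s) (k - - x n.+1) ^- p = h p (N + n.+1) - h p n.+1.
  rewrite /s big_map -ipsum_shiftD.
  by apply: eq_bigr => k _; congr (_ ^- _); rewrite /x natrD opprK addrA.
have /= := E1 1%N; have /= := E2 1%N; under eq_bigr do rewrite expr1.
move=> ->; under eq_bigr do rewrite expr1.
move=> ->; rewrite E1 E2 !ipsumS /= -/(x n.+1) (expVN _ q) (sqrrN (x _)).
have x0 : x n.+1 != 0 by rewrite gt_eqF// half_int_gt0.
have xq : x n.+1 ^+ q != 0 by rewrite expf_neq0.

by field; apply/andP.
Qed.

(** The polar parts at [m] of the products obtained by multiplying out the kernel. The fourth
    product, [a ^- q.+3], has its only pole at 0. *)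
Let rem m a :=
  (L + H 1 N - \sum_(k <- s) (k - m)^-1) * pole2_rem m a q - pole3_rem m a q
  - pole1_rem m a q.+2 + pole2_rem m a q.+1.

Let kernel_expansion (a : R) : a != 0 -> {in s, forall k : R, k - a != 0} ->
  kernel a = \sum_(i < q) coef12 i * a ^- (q - i)
    + \sum_(i < q.+2) coef1 i * a ^- (q.+2 - i)
    + \sum_(i < q.+1) (i.+1%:R * H i.+2 N) * a ^- (q.+1 - i)
    + a ^- q.+3 + \sum_(m <- s) rem m a.
Proof.
move=> a0 sa; set Z := L + H 1 N.
transitivity ((Z - \sum_(k <- s) (k - a)^-1) * (\sum_(k <- s) (k - a) ^- 2) * a ^- q
  + (Z - \sum_(k <- s) (k - a)^-1) * a ^- q.+2
  + (\sum_(k <- s) (k - a) ^- 2) * a ^- q.+1 + a ^- q.+3).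
  rewrite /kernel -/Z !exprS; have aq : a ^+ q != 0 by rewrite expf_neq0.
  by field; apply/andP.
rewrite sum_pole12_expansion// sum_pole1_expansion// sum_pole2_expansion//.
have -> : \sum_(i < q) (Z * (i.+1%:R * (\sum_(k <- s) k ^- i.+2))
      - \sum_(j < i.+1) (\sum_(k <- s) k ^- j.+1)
        * ((i - j).+1%:R * (\sum_(k <- s) k ^- (i - j).+2))) * a ^- (q - i)
    = \sum_(i < q) coef12 i * a ^- (q - i).
  (* The term [j = 0] of the convolution carries the factor [H 1 N] and cancels the [H 1 N]
     contained in [Z]; only [L] and convergent sums remain in [coef12]. *)
  apply: eq_bigr => i _; congr (_ * _); rewrite big_ord_recl subn0 /= !sumH.
  rewrite /coef12 /Z mulrDl opprD addrA addrK; congr (_ - _).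
  apply: eq_bigr => j _; rewrite !sumH /bump /= add1n.
  by have -> : (i - j.+1).+1 = (i - j)%N by have := ltn_ord j; lia.
have -> : \sum_(i < q.+2) (Z *+ (i == 0 :> nat) - \sum_(k <- s) k ^- i.+1)
      * a ^- (q.+2 - i) = \sum_(i < q.+2) coef1 i * a ^- (q.+2 - i).
  apply: eq_bigr => -[[|i] ?] _; congr (_ * _); rewrite /= !sumH /coef1.
    by rewrite mulr1n /Z addrK.
  by rewrite mulr0n sub0r.
have -> : \sum_(i < q.+1) i.+1%:R * (\sum_(k <- s) k ^- i.+2) * a ^- (q.+1 - i)
   = \sum_(i < q.+1) (i.+1%:R * H i.+2 N) * a ^- (q.+1 - i).
  by apply: eq_bigr => i _; rewrite sumH.
rewrite /rem -/Z !big_split /= !sumrN.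
by ring.
Qed.

Let rem_int_term m : (0 < m <= N)%N ->
  \sum_(1 <= n < N.+1) (rem m%:R (x n) + rem m%:R (- x n)) = int_term m.
Proof.
case: m => // m /= mN.
have SE p : \sum_(1 <= n < N.+1)
    ((m.+1%:R - x n) ^- p + (m.+1%:R - - x n) ^- p) = S p m.+1.
  rewrite big_split /=.
  have -> : \sum_(1 <= n < N.+1) (m.+1%:R - x n) ^- p
      = (-1) ^+ p * h p (N - m.+1) + h p m.+1.
    transitivity ((-1) ^+ p * \sum_(1 <= n < N.+1) (n%:R - (m.+1%:R + 2^-1) : R) ^- p).
      rewrite mulr_sumr; apply: eq_bigr => n _; rewrite -expVN; congr (_ ^- _).
      by rewrite /x; ring.
    by rewrite ipsum_shiftB// mulrDr mulrA -exprMn mulrNN mulr1 expr1n mul1r.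
  have -> : \sum_(1 <= n < N.+1) (m.+1%:R - - x n) ^- p = h p (N + m.+1) - h p m.+1.
    rewrite -ipsum_shiftD; apply: eq_bigr => n _; congr (_ ^- _).
    by rewrite /x natrD; ring.
  by ring.
have Vm : \sum_(k <- s) (k - m.+1%:R)^-1 = H 1 (N - m.+1) - H 1 m.
  by rewrite /s big_map ipsum_shift_int.
rewrite /int_term -!SE /rem Vm /pole1_rem /pole2_rem /pole3_rem /=.
rewrite !mulr_sumr -!big_split !mulr_sumr -sumrB -!big_split /=.
apply: eq_bigr => n _; rewrite !expr1 -[q.+1%:R]natr1.
by ring.
Qed.

(** The expansion of the kernel is summed over the [2 N] points [x n] and [- x n]. Opposite points
    cancel the odd powers of the polar part at 0, whence the factors [1 + (-1) ^+ j]. *)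
Lemma finite_identity :
  \sum_(1 <= n < N.+1) half_term n =
    \sum_(i < q) coef12 i * P (q - i) + \sum_(i < q.+2) coef1 i * P (q.+2 - i)
    + \sum_(i < q.+1) (i.+1%:R * H i.+2 N) * P (q.+1 - i) + P q.+3
    + \sum_(1 <= m < N.+1) int_term m.
Proof.
have PE j : P j = \sum_(1 <= n < N.+1) (x n ^- j + (- x n) ^- j).
  rewrite mulr_sumr; apply: eq_bigr => n _.
  by rewrite expVN mulrDl mul1r.
have sumP (c : nat -> R) k : \sum_(i < k) c i * P (k - i) = \sum_(1 <= n < N.+1)
    (\sum_(i < k) c i * x n ^- (k - i) + \sum_(i < k) c i * (- x n) ^- (k - i)).
  under eq_bigr do rewrite PE mulr_sumr; rewrite exchange_big /=.
  by apply: eq_bigr => n _; rewrite -big_split; apply: eq_bigr => i _; rewrite mulrDr.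
have -> : \sum_(1 <= m < N.+1) int_term m =
    \sum_(1 <= n < N.+1) (\sum_(m <- s) rem m (x n) + \sum_(m <- s) rem m (- x n)).
  under [RHS]eq_bigr do rewrite -big_split /= /s big_map.
  rewrite exchange_big /=; apply: eq_big_nat => m mN.
  by rewrite rem_int_term.
rewrite (sumP coef12) (sumP coef1) (sumP (fun i => i.+1%:R * H i.+2 N)) PE -!big_split /=.
apply: eq_big_nat => -[|n]// nN; rewrite -kernel_half_int//.
have x0 : x n.+1 != 0 by rewrite gt_eqF// half_int_gt0.
rewrite !kernel_expansion ?oppr_eq0//; first by ring.
- move=> _ /mapP[k _ ->]; rewrite opprK /x addrA -natrD gt_eqF// addnS.
  exact: half_int_gt0.
- move=> _ /mapP[k _ ->]; have -> : x n.+1 = n%:R + 2^-1.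
    by rewrite /x -natr1; field.
  exact: half_int_neq0.
Qed.

End finite_identity.

(** * Dominated convergence of series *)

Section tannery.
Variable R : realType.
Local Open Scope classical_set_scope.

Lemma cvg_sum_seq (I : Type) (r : seq I) (f : I -> nat -> R) (l : I -> R) :
  (forall i, f i n @[n --> \oo] --> l i) ->
  (\sum_(i <- r) f i n) @[n --> \oo] --> \sum_(i <- r) l i.
Proof.
move=> fl; elim: r => [|i r IH].
  by rewrite big_nil; under eq_fun do rewrite big_nil; exact: cvg_cst.
by rewrite big_cons; under eq_fun do rewrite big_cons; exact: cvgD.
Qed.

(** The sum is cut at a fixed [K]: the head converges termwise, and both tails are controlled by the
    tail of the majorant series. Domination is required only for the terms [n < N] that occur in the
    sum. *)
Lemma tannery (u : nat -> nat -> R) (w v : nat -> R) :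
  (forall n, u N n @[N --> \oo] --> w n) ->
  (forall N n, (n < N)%N -> `|u N n| <= v n) ->
  cvgn (series v) ->
  cvgn (series w) /\
  (\sum_(0 <= n < N) u N n) @[N --> \oo] --> limn (series w).
Proof.
move=> uw uv cv.
have wv n : `|w n| <= v n.
  apply: (cvgr_to_le (cvg_norm (uw n))).
  by near=> N; apply: uv; near: N; exact: nbhs_infty_gt.
have v0 n : 0 <= v n by apply: le_trans (uv _ _ (ltnSn n)).
have cw : cvgn (series w).
  by apply: normed_cvg; apply: (series_le_cvg _ v0 wv cv) => n; exact: normr_ge0.
split=> //; set W := limn (series w); set V := limn (series v).
apply/cvgrPdist_le => e e0.
have e3 : 0 < e / 3 by rewrite divr_gt0.
have [K [WK VK]] : exists K, `|W - series w K| <= e / 3 /\ V - series v K <= e / 3.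
  have /cvgrPdist_le/(_ _ e3) hw := cw; have /cvgrPdist_le/(_ _ e3) hv := cv.
  have [K _ HK] := filterI hw hv; exists K; have [? hK] := HK K (leqnn K).
  by split=> //; apply: le_trans hK; exact: ler_norm.
have tail N : \sum_(K <= n < N) v n <= e / 3.
  have [NK|KN] := leqP N K; first by rewrite big_geq// ltW.
  apply: le_trans VK; rewrite lerBrDl.
  rewrite -(sub_series_geq v (ltnW KN)) addrC subrK.
  apply: nondecreasing_cvgn_le => //.
  by move=> a b; apply: nondecreasing_series => n _ _; exact: v0.
have fin : \forall N \near \oo, `|\sum_(0 <= n < K) w n - \sum_(0 <= n < K) u N n| <= e / 3.
  by move/cvgrPdist_le : (@cvg_sum_seq nat (index_iota 0 K) (fun n N => u N n) w uw); exact.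
near=> N.
have KN : (K <= N)%N by near: N; exact: nbhs_infty_ge.
rewrite (@big_cat_nat _ _ _ K)//=.
have -> : W - (\sum_(0 <= n < K) u N n + \sum_(K <= n < N) u N n) =
  (W - series w K) + (\sum_(0 <= n < K) w n - \sum_(0 <= n < K) u N n)
  - \sum_(K <= n < N) u N n by rewrite /series /=; ring.
rewrite (le_trans (ler_normB _ _))// (_ : e = e / 3 + e / 3 + e / 3); last by field.
rewrite lerD//.
  by rewrite (le_trans (ler_normD _ _))// lerD//; near: N.
apply: le_trans (tail N); apply: le_trans (ler_norm_sum _ _ _) _.
by rewrite ler_sum_nat// => n /andP[_ nN]; exact: uv.
Unshelve. all: by end_near. Qed.

End tannery.

(** * The summable majorant h_n / x_n^2 *)

Section majorant.
Variable R : realType.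
Local Open Scope classical_set_scope.

Local Notation h := (@ipsum R 2^-1).

Definition major n : R := h 1 n * (n%:R - 2^-1) ^- 2.

(** The fraction compensates for the tail of the series: with it the left side is nonincreasing in
    [N]. Its value at [N = 0] is 8 + 8 = 16. *)
Lemma major_sum_le16 N :
  \sum_(0 <= n < N.+1) major n.+1 + (h 1 N.+1 + 2) / (N.+1%:R - 2^-1) <= 16.
Proof.
elim: N => [|N IH].
  have x1 : 1 - 2^-1 = 2^-1 :> R by field.
  by rewrite big_nat1 /major ipsumS ipsum0 expr1 !x1 -exprVn !invrK; lra.
rewrite big_nat_recr//=; apply: le_trans IH; rewrite -addrA lerD2l.
rewrite /major [in h 1 N.+2]ipsumS expr1.
have h0 : 0 <= h 1 N.+1.
  rewrite /ipsum big_nat sumr_ge0// => -[|k]// _.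
  by rewrite invr_ge0 exprn_ge0// ltW// half_int_gt0.
have -> : N.+2%:R - 2^-1 = (N.+1%:R - 2^-1) + 1 :> R by rewrite -[N.+2%:R]natr1; ring.
have : 2^-1 <= N.+1%:R - 2^-1 :> R by rewrite -[N.+1%:R]natr1; have := ler0n R N; lra.
move: (h 1 N.+1) (N.+1%:R - 2^-1) h0 => a y a0 y0.
have yp : 0 < y by lra.
(* The old fraction equals the new summand plus the new fraction plus an explicit nonnegative
   excess. *)
have -> : (a + 2) / y = (a + (y + 1)^-1) * (y + 1) ^- 2 + (a + (y + 1)^-1 + 2) / (y + 1)
   + (y ^+ 2 + (a + 2) * y + a + 2) / (y * (y + 1) ^+ 3).
  by field; rewrite !gt_eqF//; lra.
rewrite lerDl divr_ge0//; last by rewrite mulr_ge0// ?exprn_ge0//; lra.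
by have := sqr_ge0 y; nra.
Qed.

Lemma half_harmonic_ge2 n : 2 <= h 1 n.+1.
Proof.
elim: n => [|n IH].
  by rewrite ipsumS ipsum0 expr1 (_ : 1%:R - 2^-1 = 2^-1) ?invrK ?add0r//; field.
by rewrite ipsumS expr1 (le_trans IH)// lerDl invr_ge0 ltW// half_int_gt0.
Qed.

Lemma major_ge0 n : 0 <= major n.+1.
Proof.
by rewrite mulr_ge0 ?(le_trans _ (half_harmonic_ge2 n))// invr_ge0 exprn_ge0// ltW// half_int_gt0.
Qed.

Lemma cvg_major : cvgn (series (fun n => major n.+1)).
Proof.
apply: nondecreasing_is_cvgn.
  by apply: nondecreasing_series => n _ _; exact: major_ge0.
exists 16 => _ [[|N] _ <-]; first by rewrite /series /= big_geq.
apply: le_trans (major_sum_le16 N); rewrite /series /= lerDl divr_ge0//.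
  by rewrite addr_ge0// (le_trans _ (half_harmonic_ge2 N)).
by rewrite ltW// half_int_gt0.
Qed.

Lemma tannery_major (C : R) (u : nat -> nat -> R) (w : nat -> R) :
  (forall n, u N n.+1 @[N --> \oo] --> w n.+1) ->
  (forall N n, (n < N)%N -> `|u N n.+1| <= C * major n.+1) ->
  cvgn (fun N => \sum_(1 <= n < N) w n) /\
  (\sum_(1 <= n < N.+1) u N n) @[N --> \oo] --> limn (fun N => \sum_(1 <= n < N) w n).
Proof.
move=> uw uC; pose w' n := w n.+1.
have [] := @tannery _ (fun N n => u N n.+1) w' (fun n => C * major n.+1) uw uC.
  rewrite (_ : series _ = fun N => C * series (fun n => major n.+1) N).
    by apply: is_cvgM; [exact: is_cvg_cst|exact: cvg_major].
  by apply/funext => N; rewrite /series /= mulr_sumr.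
have E : series w' = [sequence \sum_(1 <= n < N.+1) w n]_N.
  by apply/funext => N; rewrite /series /= big_add1.
rewrite E => cw cu.
have cw' : (fun N => \sum_(1 <= n < N) w n) @ \oo -->
    limn [sequence \sum_(1 <= n < N.+1) w n]_N by rewrite -cvg_shiftS.
split; first by apply/cvg_ex; eexists; exact: cw'.
rewrite (cvg_lim _ cw')//; apply: cvg_trans cu; apply: near_eq_cvg.
by near=> N; rewrite big_add1.
Unshelve. all: by end_near. Qed.

Lemma cvg_sum_major (C : R) (w : nat -> R) :
  (forall n, `|w n.+1| <= C * major n.+1) ->
  (fun N => \sum_(1 <= n < N) w n) @ \oo --> limn (fun N => \sum_(1 <= n < N) w n).
Proof.
by move=> wC; have [] := @tannery_major C (fun _ => w) w (fun n => cvg_cst _) (fun _ n _ => wC n).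
Qed.

End majorant.

(** * The constants log 2 and pi^2 / 2 *)

Section log2_limit.
Variable R : realType.
Local Open Scope classical_set_scope.

Local Notation h := (@ipsum R 2^-1).
Local Notation H := (@ipsum R 0).

Let lnS_le n : ln n.+2%:R - ln n.+1%:R <= n.+1%:R^-1 :> R.
Proof.
rewrite -ln_div ?posrE//.
have -> : n.+2%:R / n.+1%:R = 1 + n.+1%:R^-1 :> R.
  by rewrite -[n.+2%:R]natr1 mulrDl mulfV ?pnatr_eq0// mul1r.
by apply: le_ln1Dx; rewrite (lt_le_trans (ltrN10 _))// invr_ge0.
Qed.

Let lnS_ge n : n.+2%:R^-1 <= ln n.+2%:R - ln n.+1%:R :> R.
Proof.
rewrite -opprB lerNr -ln_div ?posrE//.
have -> : n.+1%:R / n.+2%:R = 1 + - n.+2%:R^-1 :> R.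
  rewrite -[n.+2%:R]natr1; have := ltr0Sn R n.
  by move: (n.+1%:R) => y y0; field; rewrite gt_eqF//; lra.
apply: le_ln1Dx; rewrite ltrN2 invf_lt1// ltr1n//.
Qed.

(** Each 1/k lies between ln(k+1) - ln k and ln k - ln(k-1); these bounds telescope over k from N+2
    to N+j+1. *)
Lemma ipsum_diff_ln N j :
  ln (N + j).+2%:R - ln N.+2%:R <= H 1 (N + j).+1 - H 1 N.+1
    <= ln (N + j).+1%:R - ln N.+1%:R.
Proof.
elim: j => [|j /andP[IH1 IH2]]; first by rewrite addn0 !subrr lexx.
rewrite addnS (ipsumS _ _ (N + j).+1) expr1 subr0.
have := lnS_le (N + j).+1; have := lnS_ge (N + j).
move: (_^-1) (ln _) (ln _) (ln _) (ln _) (ln _) (H _ _) (H _ _) IH1 IH2.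
move=> ? ? ? ? ? ? ? ? IH1 IH2 A B.
by apply/andP; split; lra.
Qed.

(** Splitting [H 1 (N + N)] into odd and even denominators gives half of [h 1 N] plus half of
    [H 1 N]. *)
Lemma half_harmonicB N : h 1 N - H 1 N = 2 * (H 1 (N + N) - H 1 N).
Proof.
elim: N => [|N IH]; first by rewrite !ipsum0 subrr mulr0.
rewrite addSn addnS !ipsumS !expr1 !subr0.
have -> : h 1 N = 2 * (H 1 (N + N) - H 1 N) + H 1 N by rewrite -IH subrK.
have -> : (N + N).+2%:R = 2 * N.+1%:R :> R by rewrite -natrM; congr _%:R; lia.
have -> : (N + N).+1%:R = 2 * (N.+1%:R - 2^-1) :> R.
  by rewrite mulrBr mulfV// -natrM -[1]/(1%:R) -natrB; [congr _%:R; lia|lia].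
have := half_int_gt0 R N; have := ltr0Sn R N.
by move: (N.+1%:R) => y y0 y1; field; rewrite !gt_eqF//; lra.
Qed.

(** By [half_harmonicB] this is twice the error in H_2N - H_N -> log 2, which the logarithmic bounds
    squeeze between 0 and a harmonic term. *)
Lemma cvg_harmonicB_log2 : 2 * ln 2 + H 1 N - h 1 N @[N --> \oo] --> (0 : R).
Proof.
rewrite -cvg_shiftS /=.
have bnd N : 0 <= 2 * ln 2 + H 1 N.+1 - h 1 N.+1 <= 2 * harmonic N.+1.
  have := half_harmonicB N.+1; have /andP[] := ipsum_diff_ln N N.+1.
  have -> : (N + N.+1).+1%:R = 2 * N.+1%:R :> R by rewrite -natrM; congr _%:R; lia.
  have -> : (N.+1 + N.+1)%N = (N + N.+1).+1 by lia.
  rewrite lnM ?posrE// addrK => A B C.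
  have D : (ln 2 + ln N.+2%:R - ln (N + N.+1).+2%:R : R) <= harmonic N.+1.
    have -> : ln 2 + ln N.+2%:R = ln (2 * N.+2%:R) :> R by rewrite lnM ?posrE.
    rewrite -ln_div ?posrE ?mulr_gt0//.
    have -> : 2 * N.+2%:R / (N + N.+1).+2%:R = 1 + (N + N.+1).+2%:R^-1 :> R.
      have -> : 2 * N.+2%:R = (N + N.+1).+2%:R + 1 :> R.
        by rewrite -natrM -[1]/(1%:R) -natrD; congr _%:R; lia.
      by rewrite mulrDl mulfV ?pnatr_eq0// mul1r.
    apply: le_trans (le_ln1Dx _) _.
      by rewrite (lt_le_trans (ltrN10 _))// invr_ge0.
    by rewrite /harmonic lef_pV2 ?posrE// ler_nat; lia.
  move: (harmonic _) A B C D => *; apply/andP; split; lra.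
apply: (@squeeze_cvgr _ _ _ _ (fun=> 0) (fun N => 2 * harmonic N.+1)).
- by near=> N; exact: bnd.
- exact: cvg_cst.
- rewrite -[0](mulr0 2); apply: cvgM; first exact: cvg_cst.
  by have := @cvg_harmonic R; rewrite -cvg_shiftS.
Unshelve. all: by end_near. Qed.

End log2_limit.

(** * The sum of x_n^-2 by angle doubling *)

Section basel.
Variable R : realType.
Local Open Scope classical_set_scope.

Local Notation h := (@ipsum R 2^-1).

Lemma sin_le_id (y : R) : 0 < y -> y < pi / 2 -> sin y <= y.
Proof.
move=> y0 y2; have [|c cy] := @MVT _ sin cos 0 y y0 (fun t _ => is_derive_sin t).
  by apply: continuous_subspaceT => t; exact: continuous_sin.
by rewrite sin0 !subr0 => ->; rewrite ler_piMl ?cos_le1// ltW.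
Qed.

(** Equivalently [y <= tan y], which the mean value theorem gives because the derivative
    [(cos t) ^- 2] of [tan] is at least 1. *)
Lemma cos_mul_le_sin (y : R) : 0 < y -> y < pi / 2 -> y * cos y <= sin y.
Proof.
move=> y0 y2.
have cos0 t : t \in `[0, y]%R -> 0 < cos t.
  rewrite in_itv /= => /andP[t0 ty]; apply: cos_gt0_pihalf.
  by rewrite (le_lt_trans ty y2) andbT (lt_le_trans _ t0)// oppr_lt0 divr_gt0// pi_gt0.
have [||c cy] := @MVT _ tan (fun t => (cos t) ^- 2) 0 y y0.
- move=> t ty; apply: is_derive_tan; rewrite gt_eqF// cos0//.
  by move: ty; rewrite !in_itv /= => /andP[/ltW -> /ltW ->].
- apply: continuous_in_subspaceT => t ty; apply: continuous_tan.
  by rewrite gt_eqF// cos0//; exact: set_mem ty.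
have cc : 0 < cos c.
  by rewrite cos0//; move: cy; rewrite !in_itv /= => /andP[/ltW -> /ltW ->].
have cyy : 0 < cos y by rewrite cos0// in_itv /= lexx ltW.
rewrite tan0 !subr0 /tan => E.
have : y <= sin y / cos y.
  rewrite E; apply: ler_peMl; first exact: ltW.
  by rewrite invf_ge1 ?exprn_gt0// exprn_ile1 ?cos_le1// ltW.
by rewrite ler_pdivlMr.
Qed.

Let f (y : R) := (sin y) ^- 2.

Let f_double y : 0 < y < pi / 2 -> f y + f (pi / 2 - y) = 4 * f (2 * y).
Proof.
move=> /andP[y0 y2]; have s0 : sin y != 0 by rewrite gt_eqF// sin_gt0_pihalf ?y0.
have c0 : cos y != 0.
  by rewrite gt_eqF// cos_gt0_pihalf// y2 andbT (lt_trans _ y0)// oppr_lt0 (lt_trans y0).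
rewrite /f [2 * y]mulr_natl sin_mulr2n.
have -> : sin (pi / 2 - y) = cos y by rewrite -opprB sinN sinBpihalf opprK.
have -> : sin y ^- 2 + cos y ^- 2 = (cos y ^+ 2 + sin y ^+ 2) / (cos y ^+ 2 * sin y ^+ 2).
  by field; apply/andP.
by rewrite cos2Dsin2 -mulr_natr; field; apply/andP.
Qed.

(** Doubling an angle of level [n.+1] gives the angle of level [n] with the same [k], and the
    reflection [pi / 2 - y] sends [k] to [2 ^ n.+1 - 1 - k] within level [n.+1]. *)
Let ang n k : R := (2 * k%:R + 1) * pi / 2 ^+ n.+2.

Let ang_bound n k : (k < 2 ^ n)%N -> 0 < ang n k < pi / 2.
Proof.
move=> kn; have p0 := pi_gt0 R; apply/andP; split.
  by rewrite divr_gt0 ?exprn_gt0// mulr_gt0// ltr_wpDl// mulr_ge0.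
rewrite /ang ltr_pdivrMr ?exprn_gt0// mulrC -mulrA ltr_pM2l//.
have -> : 2^-1 * 2 ^+ n.+2 = 2 * 2 ^+ n :> R by rewrite !exprS; field.
rewrite -natrX -!natrM -[1]/(1%:R) -natrD ltr_nat; lia.
Qed.

Let sum_f n : \sum_(0 <= k < 2 ^ n) f (ang n k) = 2 * 4 ^+ n.
Proof.
elim: n => [|n IH].
  rewrite expn0 big_nat1 expr0 mulr1 /ang mulr0 add0r mul1r.
  (* The only angle of level 0 is pi/4, fixed by the reflection, so [f_double] yields its value
     2. *)
  have := @f_double (pi / 2 ^+ 2); have := pi_gt0 R => p0.
  have -> : pi / 2 - pi / 2 ^+ 2 = pi / 2 ^+ 2 :> R by field.
  have -> : 2 * (pi / 2 ^+ 2) = pi / 2 :> R by field.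
  have -> : f (pi / 2) = 1 by rewrite /f sin_pihalf expr1n invr1.
  have b : 0 < (pi / 2 ^+ 2 : R) < pi / 2 by apply/andP; split; lra.
  by move=> /(_ b); lra.
have -> : (2 ^ n.+1 = 2 ^ n + 2 ^ n)%N by rewrite expnS mul2n addnn.
rewrite (@big_cat_nat _ _ _ (2 ^ n)) ?leq_addr//=.
(* Reversing the second half pairs each angle with its reflection, and each pair contributes 4 times
   a term of level [n]. *)
rewrite [X in _ + X]big_nat_rev /= -{2}[(2 ^ n)%N]add0n big_addn addnK -big_split /=.
rewrite exprS mulrCA -IH mulr_sumr; apply: eq_big_nat => k /andP[_ kn].
have -> : ang n k = 2 * ang n.+1 k by rewrite /ang [2 ^+ n.+3]exprS; field; rewrite expf_neq0.
rewrite -f_double; last first.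
  by apply: ang_bound; rewrite (leq_trans kn)// leq_exp2l.
congr (_ + f _); rewrite /ang.
have -> : (2 ^ n + (2 ^ n + 2 ^ n) - (k + 2 ^ n).+1 = 2 ^ n + 2 ^ n - k.+1)%N by lia.
rewrite natrB; last by lia.
rewrite natrD natrX -[k.+1%:R]natr1 [2 ^+ n.+3]exprS [2 ^+ n.+2]exprS [2 ^+ n.+1]exprS.
have : 2 ^+ n != 0 :> R by rewrite expf_neq0.
by move: (2 ^+ n) => y y0; field.
Qed.

Let h2_sum_ang n :
  \sum_(0 <= k < 2 ^ n) (ang n k) ^- 2 = 4 ^+ n.+1 / pi ^+ 2 * h 2 (2 ^ n).
Proof.
rewrite /ipsum big_add1 /= mulr_sumr; apply: eq_bigr => k _.
have -> : 4 = 2 ^+ 2 :> R by rewrite -natrX.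
rewrite /ang -exprM mulnC exprM [2 ^+ n.+2]exprS -[k.+1%:R]natr1.
have : 2 ^+ n.+1 != 0 :> R by rewrite expf_neq0.
have := pi_gt0 R; have := ler0n R k.
move: (2 ^+ n.+1) (pi) (k%:R) => y p c c0 p0 y0; field.
by rewrite y0 !gt_eqF//; lra.
Qed.

(** For y in (0, pi/2) one has 1/sin^2 y - 1 <= 1/y^2 <= 1/sin^2 y. Summed over the 2^n angles, this
    leaves an error of at most pi^2 / (4 * 2^n), which is weakened to a harmonic term. *)
Let h2_bounds n :
  pi ^+ 2 / 2 - pi ^+ 2 * harmonic n <= h 2 (2 ^ n) <= pi ^+ 2 / 2.
Proof.
have p0 := pi_gt0 R.
have S1 : 4 ^+ n.+1 / pi ^+ 2 * h 2 (2 ^ n) <= 2 * 4 ^+ n.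
  rewrite -h2_sum_ang -sum_f; apply: ler_sum_nat => k /andP[_ kn].
  have /andP[a0 a2] := ang_bound kn.
  have s0 : 0 < sin (ang n k) by apply: sin_gt0_pihalf; rewrite a0.
  rewrite /f lef_pV2 ?posrE ?exprn_gt0//.
  by apply: lerXn2r; rewrite ?nnegrE; [exact: ltW|exact: ltW|exact: sin_le_id].
have S2 : 2 * 4 ^+ n - 2 ^+ n <= 4 ^+ n.+1 / pi ^+ 2 * h 2 (2 ^ n).
  rewrite -h2_sum_ang -sum_f lerBlDr.
  have -> : 2 ^+ n = \sum_(0 <= k < 2 ^ n) 1 :> R.
    by rewrite big_const_nat subn0 iter_addr_0 natrX.
  rewrite -big_split; apply: ler_sum_nat => k /andP[_ kn].
  have /andP[a0 a2] := ang_bound kn.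
  have s0 : 0 < sin (ang n k) by apply: sin_gt0_pihalf; rewrite a0.
  have := cos_mul_le_sin a0 a2; have := cos2Dsin2 (ang n k).
  have c0 : 0 <= cos (ang n k).
    apply: cos_ge0_pihalf; rewrite (ltW a2) andbT (le_trans _ (ltW a0))//.
    by rewrite oppr_le0 divr_ge0// ltW.
  rewrite /f; move: (ang n k) (sin _) (cos _) a0 s0 c0 => y s c y0 s0 c0 E ycs.
  rewrite -[1](@mulfV _ (s ^+ 2)) ?gt_eqF ?exprn_gt0//.
  rewrite -subr_ge0.
  have -> : y ^- 2 + s ^+ 2 / s ^+ 2 - s ^- 2 = (s ^+ 2 - (y * c) ^+ 2) / (y ^+ 2 * s ^+ 2).
    have -> : s ^+ 2 = 1 - c ^+ 2 by rewrite -E; ring.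
    field; apply/andP; split; last by rewrite gt_eqF.
    have -> : 1 - c ^+ 2 = s ^+ 2 by rewrite -E; ring.
    by rewrite expf_neq0 ?gt_eqF.
  apply: divr_ge0; last by rewrite mulr_ge0// exprn_ge0// ltW.
  rewrite subr_ge0.
  by apply: lerXn2r; rewrite ?nnegrE// ?mulr_ge0// ltW.
have q4 : 0 < 4 ^+ n :> R by rewrite exprn_gt0.
have q2 : 2 ^+ n * harmonic n >= 1 :> R.
  by rewrite /harmonic -natrX ler_pdivlMr// mul1r ler_nat ltn_expl.
have E4 : 4 ^+ n = 2 ^+ n * 2 ^+ n :> R by rewrite -exprMn -natrM.
have q22 : 0 < 2 ^+ n :> R by rewrite exprn_gt0.
move: S1 S2; rewrite [4 ^+ n.+1]exprS E4.
move: (2 ^+ n) (h 2 _) (harmonic n) q2 q22 => y X hn hy y0 S1 S2.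
have pp : 0 < pi ^+ 2 :> R by rewrite exprn_gt0.
move: (@pi R) p0 pp S1 S2 => p p0 pp S1 S2.
have XE : X = p ^+ 2 / (4 * (y * y)) * (4 * (y * y) / p ^+ 2 * X).
  by field; rewrite !gt_eqF.
have k0 : 0 < p ^+ 2 / (4 * (y * y)) :> R by rewrite divr_gt0 ?mulr_gt0.
apply/andP; split.
  rewrite XE; apply: le_trans (_ : _ <= p ^+ 2 / (4 * (y * y)) * (2 * (y * y) - y)) _; last first.
    by rewrite ler_pM2l.
  have -> : p ^+ 2 / (4 * (y * y)) * (2 * (y * y) - y) = p ^+ 2 / 2 - p ^+ 2 * (4 * y)^-1 :> R.
    by field; rewrite gt_eqF.
  rewrite lerD2l lerN2 ler_pM2l// invfM (le_trans (_ : _ <= y^-1))//.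
    by rewrite ler_piMl ?invr_ge0 ?ltW//; lra.
  by rewrite -[y^-1]mul1r ler_pdivrMr// mulrC.
rewrite XE; apply: le_trans (_ : _ <= p ^+ 2 / (4 * (y * y)) * (2 * (y * y))) _.
  by rewrite ler_pM2l.
rewrite le_eqVlt; apply/orP; left; apply/eqP.
by field; rewrite gt_eqF.
Qed.

(** Since [h 2] is nondecreasing, the bounds along the indices [2 ^ n] determine its limit. *)
Lemma cvg_half_sum2 : h 2 N @[N --> \oo] --> pi ^+ 2 / 2.
Proof.
have nd : nondecreasing_seq (h 2).
  apply/nondecreasing_seqP => n; rewrite ipsumS lerDl invr_ge0 exprn_ge0//.
  by rewrite ltW// half_int_gt0.
have ub N : h 2 N <= pi ^+ 2 / 2.
  have /andP[_] := h2_bounds N; apply: le_trans; apply: nd.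
  by rewrite ltnW// ltn_expl.
have cv : cvgn (h 2) by apply: nondecreasing_is_cvgn => //; exists (pi ^+ 2 / 2) => _ [n _ <-].
suff <- : limn (h 2) = pi ^+ 2 / 2 by [].
apply/eqP; rewrite eq_le; apply/andP; split.
  by apply: limr_le => //; near=> N.
have lb n : pi ^+ 2 / 2 - pi ^+ 2 * harmonic n <= limn (h 2).
  have /andP[A _] := h2_bounds n; apply: le_trans A _.
  exact: nondecreasing_cvgn_le.
have c : (pi ^+ 2 / 2 - pi ^+ 2 * harmonic n) @[n --> \oo] --> (pi ^+ 2 / 2 : R).
  rewrite -[X in _ --> X]subr0; apply: cvgB; first exact: cvg_cst.
  rewrite -[X in _ --> X](mulr0 (pi ^+ 2)); apply: cvgM; first exact: cvg_cst.
  exact: cvg_harmonic.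
apply: (cvgr_to_le c); near=> n; exact: lb.
Unshelve. all: by end_near. Qed.

End basel.

(** * Termwise limits and bounds *)

Lemma half_ge0 (R : realType) : 0 <= 2^-1 :> R.
Proof. by rewrite invr_ge0. Qed.

Section ipsum_bounds.
Variables (R : realType) (c : R).
Hypotheses (c_le : c <= 2^-1).
Implicit Types p N j : nat.

Let pos n : 0 < n.+1%:R - c.
Proof. by apply: lt_le_trans (half_int_gt0 R n) _; rewrite lerD2l lerN2. Qed.

Lemma ipsum_nd p N M : (N <= M)%N -> ipsum c p N <= ipsum c p M.
Proof.
move=> NM; rewrite -(subnKC NM); elim: (M - N)%N => [|j IH]; first by rewrite addn0.
by rewrite addnS ipsumS (le_trans IH)// lerDl invr_ge0 exprn_ge0// ltW.
Qed.

Lemma ipsum_ge0 p N : 0 <= ipsum c p N.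
Proof. by rewrite -(ipsum0 c p); exact: ipsum_nd. Qed.

(** The summands decrease, so the [j] terms following the [N]-th are at most the first [j] ones. *)
Lemma ipsum_subadd p N j : ipsum c p (N + j) <= ipsum c p N + ipsum c p j.
Proof.
elim: j => [|j IH]; first by rewrite addn0 ipsum0 addr0.
rewrite addnS !ipsumS addrA lerD//.
rewrite lef_pV2 ?posrE ?exprn_gt0//; apply: lerXn2r; rewrite ?nnegrE ?(ltW (pos _))//.
by rewrite lerD2r ler_nat ltnS leq_addl.
Qed.

Lemma ipsum_le_half p N : ipsum c p N <= ipsum 2^-1 p N.
Proof.
elim: N => [|N IH]; first by rewrite !ipsum0.
rewrite !ipsumS lerD// lef_pV2 ?posrE ?exprn_gt0 ?half_int_gt0//.
by apply: lerXn2r; rewrite ?nnegrE ?(ltW (pos _)) ?(ltW (half_int_gt0 _ _))// lerD2l lerN2.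
Qed.

(** As x = n + 1/2 is at least 1/2, the surplus power x^-(p-2) is at most 2^(p-2). *)
Lemma pow_le_major p n : (1 < p)%N ->
  (n.+1%:R - c) ^- p * ipsum 2^-1 1 n.+1 <= 2 ^+ p * major R n.+1.
Proof.
move=> p1; rewrite /major mulrCA [X in X <= _]mulrC; apply: ler_wpM2l.
  by rewrite (le_trans _ (half_harmonic_ge2 R n)).
set x := n.+1%:R - 2^-1; have x0 : 0 < x := half_int_gt0 R n.
apply: (@le_trans _ _ (x ^- p)).
  rewrite lef_pV2 ?posrE ?exprn_gt0//.
  by apply: lerXn2r; rewrite ?nnegrE ?(ltW (pos _)) ?(ltW x0)// lerD2l lerN2.
have -> : p = (p - 2 + 2)%N by lia.
rewrite exprD invfM; apply: ler_wpM2r; first by rewrite invr_ge0 exprn_ge0 ?(ltW x0).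
have xV : x^-1 <= 2.
  have -> : 2 = (2^-1)^-1 :> R by rewrite invrK.
  rewrite lef_pV2 ?posrE ?invr_gt0// /x -[n.+1%:R]natr1.
  by have := ler0n R n; lra.
rewrite -exprVn; apply: (@le_trans _ _ (2 ^+ (p - 2))).
  by apply: lerXn2r; rewrite ?nnegrE ?invr_ge0 ?(ltW x0).
by rewrite ler_eXn2l ?leq_addr// ltr1n.
Qed.

Lemma pow_le_major1 p n : (1 < p)%N -> (n.+1%:R - c) ^- p <= 2 ^+ p * major R n.+1.
Proof.
move=> p1; apply: le_trans (pow_le_major n p1); apply: ler_peMr.
  by rewrite invr_ge0 exprn_ge0 ?(ltW (pos n)).
by apply: le_trans (half_harmonic_ge2 R n); rewrite ler1n.
Qed.

Local Open Scope classical_set_scope.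

Lemma mharm1E p : mharm c [:: p] = fun N => \sum_(1 <= n < N) (n%:R - c) ^- p.
Proof. by apply/funext => N /=; apply: eq_bigr => n _; rewrite mulr1. Qed.

Lemma mharm1S p N : mharm c [:: p] N.+1 = ipsum c p N.
Proof. by rewrite mharm1E. Qed.

Lemma cvg_ipsum p : (1 < p)%N -> ipsum c p N @[N --> \oo] --> limn (mharm c [:: p]).
Proof.
move=> p1; have : mharm c [:: p] @ \oo --> limn (mharm c [:: p]).
  rewrite mharm1E; apply: (@cvg_sum_major _ (2 ^+ p)) => n.
  by rewrite ger0_norm ?invr_ge0 ?exprn_ge0 ?(ltW (pos _))//; exact: pow_le_major1.
rewrite -cvg_shiftS; apply: cvg_trans; apply: near_eq_cvg.
by near=> N; rewrite -mharm1S.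
Unshelve. all: by end_near. Qed.

Lemma ipsum_bounded p : (1 < p)%N -> exists2 K, 0 <= K & forall N, ipsum c p N <= K.
Proof.
move=> p1; exists (limn (ipsum c p)).
  apply: le_trans (ipsum_ge0 p 0) _; apply: nondecreasing_cvgn_le => //.
    by move=> a b; exact: ipsum_nd.
  exact/cvgP/cvg_ipsum.
move=> N; apply: nondecreasing_cvgn_le => //; first by move=> a b; exact: ipsum_nd.
exact/cvgP/cvg_ipsum.
Qed.

Lemma cvg_ipsum1_diff : ipsum c 1 N.+1 - ipsum c 1 N @[N --> \oo] --> (0 : R).
Proof.
apply: (@squeeze_cvgr _ _ _ _ (fun=> 0) (fun N => 2 * harmonic N)).
- near=> N; rewrite ipsumS addrC addKr expr1 invr_ge0 (ltW (pos N)) /=.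
  rewrite /harmonic -[2]invrK -invfM lef_pV2 ?posrE ?mulr_gt0//.
  rewrite -[N.+1%:R]natr1; have := ler0n R N; have := c_le.
  by lra.
- exact: cvg_cst.
- rewrite -[0](mulr0 2); apply: cvgM; first exact: cvg_cst.
  exact: cvg_harmonic.
Unshelve. all: by end_near. Qed.

End ipsum_bounds.

Section shift_limits.
Variable R : realType.
Local Open Scope classical_set_scope.
Implicit Types u : nat -> R.

(** Meant for the harmonic numbers of order 1: they diverge, but a fixed shift of the index changes
    them by a null sequence. *)
Lemma cvg_diff_addn u j : u N.+1 - u N @[N --> \oo] --> (0 : R) ->
  u (N + j)%N - u N @[N --> \oo] --> (0 : R).
Proof.
move=> u0; elim: j => [|j IH].
  by under eq_fun do rewrite addn0 subrr; exact: cvg_cst.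
have := u0; rewrite -(cvg_shiftn j) /= => uj.
rewrite (_ : (fun N => _) =
    fun N => (u (N + j).+1 - u (N + j)%N) + (u (N + j)%N - u N)).
  by rewrite -[0]addr0; exact: cvgD.
by apply/funext => N; rewrite addnS; ring.
Qed.

Lemma cvg_diff_subn u j : u N.+1 - u N @[N --> \oo] --> (0 : R) ->
  u (N - j)%N - u N @[N --> \oo] --> (0 : R).
Proof.
move=> /(cvg_diff_addn j) u0; rewrite -(cvg_shiftn j).
have u1 : - (u (N + j)%N - u N) @[N --> \oo] --> (0 : R).
  by rewrite -[X in _ --> X]oppr0; exact: cvgN.
apply: cvg_trans u1; apply: near_eq_cvg.
by near=> N; rewrite /= addnK opprB.
Unshelve. all: by end_near. Qed.

Lemma cvg_addn u j (l : R) : u @ \oo --> l -> u (N + j)%N @[N --> \oo] --> l.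
Proof. by rewrite -(cvg_shiftn j). Qed.

Lemma cvg_subn u j (l : R) : u @ \oo --> l -> u (N - j)%N @[N --> \oo] --> l.
Proof. by rewrite -(cvg_centern j). Qed.

End shift_limits.

Ltac cvg_arith := repeat first
  [ eassumption | exact: cvg_cst | apply: cvgM | apply: cvgD | apply: cvgN ].

Section term_limits.
Variables (R : realType) (q : nat).
Local Open Scope classical_set_scope.

Local Notation h := (@ipsum R 2^-1).
Local Notation H := (@ipsum R 0).
Local Notation L := (2 * ln 2 : R).
Local Notation t2 := (pi ^+ 2 / 2 : R).

(** The two products are the values of (psi(-s) + gamma + 2 log 2) psi'(-s) at [s = x n] and
    [s = - x n], with psi'(1/2) = pi^2 / 2. *)
Definition half_lim n : R :=
  (h 1 n * (t2 + h 2 n) + (-1) ^+ q * h 1 n.-1 * (t2 - h 2 n.-1)) * (n%:R - 2^-1) ^- q.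

(** In [int_term] the combinations of orders 1 and 3 tend to 0, and the one of order 2 tends to
    [2 * t2]. *)
Definition int_lim m : R :=
  2 * t2 * ((L + H 1 m.-1) * m%:R ^- q - (q%:R - 1) * m%:R ^- q.+1).

Lemma cvg_half_term n : half_term L q N n.+1 @[N --> \oo] --> half_lim n.+1.
Proof.
(* The divergent sums are regrouped into the null sequences [A], [B] and [D]. *)
pose A N := L + H 1 N - h 1 N; pose B N := h 1 (N - n) - h 1 N.
pose D N := h 1 (N + n.+1) - h 1 N.
have cA : A @ \oo --> (0 : R) by exact: cvg_harmonicB_log2.
have cB : B @ \oo --> (0 : R) by apply/cvg_diff_subn/cvg_ipsum1_diff.
have cD : D @ \oo --> (0 : R) by apply/cvg_diff_addn/cvg_ipsum1_diff.
have c1 : h 2 (N - n) @[N --> \oo] --> t2 by exact/cvg_subn/cvg_half_sum2.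
have c2 : h 2 (N + n.+1) @[N --> \oo] --> t2 by exact/cvg_addn/cvg_half_sum2.
rewrite (_ : half_term L q ^~ n.+1 = fun N =>
  ((A N - B N + h 1 n.+1) * (h 2 (N - n) + h 2 n.+1)
   + (-1) ^+ q * (A N - D N + h 1 n) * (h 2 (N + n.+1) - h 2 n)) * (n.+1%:R - 2^-1) ^- q).
  rewrite (_ : half_lim n.+1 = ((0 - 0 + h 1 n.+1) * (t2 + h 2 n.+1)
   + (-1) ^+ q * (0 - 0 + h 1 n) * (t2 - h 2 n)) * (n.+1%:R - 2^-1) ^- q).
    by cvg_arith.
  by rewrite /half_lim subr0 !add0r.
apply/funext => N; rewrite /half_term /A /B /D /=; congr (_ * _); ring.
Qed.

Lemma cvg_int_term m : int_term L q N m.+1 @[N --> \oo] --> int_lim m.+1.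
Proof.
pose A N := H 1 (N - m.+1) - H 1 N; pose B N := h 1 (N - m.+1) - h 1 N.
pose D N := h 1 (N + m.+1) - h 1 N.
pose t3 : R := limn (mharm 2^-1 [:: 3%N]).
have cA : A @ \oo --> (0 : R) by apply/cvg_diff_subn/cvg_ipsum1_diff.
have cB : B @ \oo --> (0 : R) by apply/cvg_diff_subn/cvg_ipsum1_diff.
have cD : D @ \oo --> (0 : R) by apply/cvg_diff_addn/cvg_ipsum1_diff.
have c1 : h 2 (N - m.+1) @[N --> \oo] --> t2 by exact/cvg_subn/cvg_half_sum2.
have c2 : h 2 (N + m.+1) @[N --> \oo] --> t2 by exact/cvg_addn/cvg_half_sum2.
have c3 : h 3 (N - m.+1) @[N --> \oo] --> t3 by exact/cvg_subn/cvg_ipsum.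
have c4 : h 3 (N + m.+1) @[N --> \oo] --> t3 by exact/cvg_addn/cvg_ipsum.
pose f (a b d s t u v : R) := (L + H 1 m - a)
     * (q%:R * m.+1%:R ^- q.+1 * (d - b) + m.+1%:R ^- q * (s + t))
  - (q%:R * q.+1%:R / 2 * m.+1%:R ^- q.+2 * (d - b) + q%:R * m.+1%:R ^- q.+1 * (s + t)
     + m.+1%:R ^- q * (u - v))
  + (q%:R * m.+1%:R ^- q.+2 * (d - b) + m.+1%:R ^- q.+1 * (s + t)).
rewrite (_ : int_term L q ^~ m.+1 = fun N => f (A N) (B N) (D N)
  (h 2 (N + m.+1)) (h 2 (N - m.+1)) (h 3 (N + m.+1)) (h 3 (N - m.+1))).
  rewrite (_ : int_lim m.+1 = f 0 0 0 t2 t2 t3 t3).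
    by rewrite /f; cvg_arith.
  by rewrite /f /int_lim /=; ring.
by apply/funext => N; rewrite /int_term /f /A /B /D /=; ring.
Qed.

Hypothesis q_gt1 : (1 < q)%N.

Let normM_le (a b A B : R) : `|a| <= A -> `|b| <= B -> `|a * b| <= A * B.
Proof. by move=> aA bB; rewrite normrM ler_pM. Qed.

Let normD_le (a b A B : R) : `|a| <= A -> `|b| <= B -> `|a + b| <= A + B.
Proof. by move=> aA bB; rewrite (le_trans (ler_normD _ _))// lerD. Qed.

Let normB_le (a b A B : R) : `|a| <= A -> `|b| <= B -> `|a - b| <= A + B.
Proof. by move=> aA bB; rewrite (le_trans (ler_normB _ _))// lerD. Qed.

Let ge0_norm_le (a A : R) : 0 <= a -> a <= A -> `|a| <= A.
Proof. by move=> a0 aA; rewrite ger0_norm. Qed.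

(** [L + H 1 N - h 1 N] is bounded, being convergent, and by subadditivity the shifts cost a
    multiple of [h 1 n.+1]. The sums of order 2 are bounded. *)
Lemma half_term_bound :
  exists C, forall N n, (n < N)%N -> `|half_term L q N n.+1| <= C * major R n.+1.
Proof.
have [K2 K20 hK2] := @ipsum_bounded R 2^-1 (lexx _) 2 isT.
have [K K0 hK] : exists2 K : R, 0 <= K & forall N, `|L + H 1 N - h 1 N| <= K.
  have [K hK] : has_ubound [set `|L + H 1 n - h 1 n| | n in setT].
    exact/cvg_has_ub/cvgP/cvg_harmonicB_log2.
  have {}hK N : `|L + H 1 N - h 1 N| <= K by apply: hK; exists N.
  by exists K => //; apply: le_trans (hK 0%N).
exists ((K + 2) * (2 * K2) * 2 * 2 ^+ q) => N n nN.
have h1 := half_harmonic_ge2 R n; have hS j : 0 <= h 2 j by exact: ipsum_ge0.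
have hn : h 1 n <= h 1 n.+1 by apply: ipsum_nd.
have hn0 : 0 <= h 1 n by exact: ipsum_ge0.
have a1 : `|L + H 1 N - h 1 (N - n) + h 1 n.+1| <= (K + 2) * h 1 n.+1.
  have -> : L + H 1 N - h 1 (N - n) + h 1 n.+1 =
    (L + H 1 N - h 1 N) + (h 1 N - h 1 (N - n) + h 1 n.+1) by ring.
  apply: le_trans (_ : K + 2 * h 1 n.+1 <= _); last by nra.
  apply: normD_le => //; apply: ge0_norm_le.
    have : h 1 (N - n) <= h 1 N by apply: ipsum_nd => //; exact: leq_subr.
    by lra.
  have := @ipsum_subadd R 2^-1 (lexx _) 1 (N - n) n; rewrite subnK ?(ltnW nN)//.
  by lra.
have a2 : `|L + H 1 N - h 1 (N + n.+1) + h 1 n| <= (K + 2) * h 1 n.+1.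
  have -> : L + H 1 N - h 1 (N + n.+1) + h 1 n =
    (L + H 1 N - h 1 N) + (h 1 n - (h 1 (N + n.+1) - h 1 N)) by ring.
  apply: le_trans (_ : K + (h 1 n.+1 + h 1 n.+1) <= _); last by nra.
  apply: normD_le => //; apply: normB_le; apply: ge0_norm_le => //.
    by rewrite subr_ge0; apply: ipsum_nd => //; exact: leq_addr.
  have := @ipsum_subadd R 2^-1 (lexx _) 1 N n.+1.
  by lra.
have b1 : `|h 2 (N - n) + h 2 n.+1| <= 2 * K2.
  by rewrite mulr_natl mulr2n; apply: normD_le; apply: ge0_norm_le.
have b2 : `|h 2 (N + n.+1) - h 2 n| <= 2 * K2.
  by rewrite mulr_natl mulr2n; apply: normB_le; apply: ge0_norm_le.
have x0 : 0 <= (n.+1%:R - 2^-1 : R) ^- q.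
  by rewrite invr_ge0 exprn_ge0// ltW// half_int_gt0.
have sgn : `|(-1) ^+ q : R| <= 1 by rewrite normrX normrN1 expr1n.
rewrite /half_term /=.
apply: (@le_trans _ _ (((K + 2) * h 1 n.+1 * (2 * K2) + 1 * ((K + 2) * h 1 n.+1) * (2 * K2))
   * (n.+1%:R - 2^-1) ^- q)).
  apply: normM_le; last exact: ge0_norm_le.
  by apply: normD_le; apply: normM_le => //; exact: normM_le.
have -> : ((K + 2) * h 1 n.+1 * (2 * K2) + 1 * ((K + 2) * h 1 n.+1) * (2 * K2))
   * (n.+1%:R - 2^-1) ^- q = (K + 2) * (2 * K2) * 2 * ((n.+1%:R - 2^-1) ^- q * h 1 n.+1) by ring.
rewrite -[X in _ <= X]mulrA; apply: ler_wpM2l; last exact: pow_le_major.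
by rewrite !mulr_ge0// addr_ge0.
Qed.

Lemma half_harmonic_le_nat n : h 1 n <= 2 * n%:R.
Proof.
elim: n => [|n IH]; first by rewrite ipsum0 mulr0.
rewrite ipsumS expr1 -[n.+1%:R in leRHS]natr1 mulrDr mulr1; apply: lerD => //.
rewrite -[X in _ <= X]invrK lef_pV2 ?posrE ?half_int_gt0 ?invr_gt0// -[n.+1%:R]natr1.
by have := ler0n R n; lra.
Qed.

Lemma int_term_bound :
  exists C, forall N m, (m < N)%N -> `|int_term L q N m.+1| <= C * major R m.+1.
Proof.
have [K2 K20 hK2] := @ipsum_bounded R 2^-1 (lexx _) 2 isT.
have [K3 K30 hK3] := @ipsum_bounded R 2^-1 (lexx _) 3 isT.
pose Q : R := q%:R; pose Q' : R := q%:R * q.+1%:R / 2.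
have Q0 : 0 <= Q by [].
have Q'0 : 0 <= Q' by rewrite divr_ge0// mulr_ge0.
pose D := Q' * 1 * 4 + Q * 1 * (K2 + K2) + (K3 + K3) + (Q * 1 * 4 + 1 * (K2 + K2)).
have D0 : 0 <= D by rewrite !addr_ge0// !mulr_ge0// addr_ge0.
exists ((((`|L| + 2) * (Q * 4 + (K2 + K2)) + D)) * 2 ^+ q) => N m mN.
have h1 := half_harmonic_ge2 R m; have hS p j : 0 <= h p j by exact: ipsum_ge0.
set y : R := m.+1%:R.
have y0 : 0 < y by [].
have y1 : `|y^-1| <= 1 by rewrite ger0_norm ?invr_ge0// invf_le1 ?ler1n.
have A : `|L + H 1 N - H 1 (N - m.+1) + H 1 m| <= (`|L| + 2) * h 1 m.+1.
  have -> : L + H 1 N - H 1 (N - m.+1) + H 1 m =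
     L + (H 1 N - H 1 (N - m.+1) + H 1 m) by ring.
  apply: le_trans (_ : `|L| + (h 1 m.+1 + h 1 m.+1) <= _); last first.
    by have := normr_ge0 L; nra.
  have Hh j : H 1 j <= h 1 j by exact: ipsum_le_half.
  apply: normD_le => //; apply: normD_le; apply: ge0_norm_le.
  - by rewrite subr_ge0; apply: ipsum_nd => //; exact: leq_subr.
  - have := @ipsum_subadd R 0 (half_ge0 R) 1 (N - m.+1) m.+1; rewrite subnK//.
    by have := Hh m.+1; lra.
  - exact: ipsum_ge0.
  - by apply: le_trans (Hh m) _; apply: ipsum_nd.
(* The order 1 combination is bounded only after division by [y]: subadditivity, used twice, bounds
   it by [2 * h 1 m.+1], hence by [4 * y]. In [int_term] it always comes with such a factor. *)
have S1 : `|(h 1 (N + m.+1) + (-1) ^+ 1 * h 1 (N - m.+1)) / y| <= 4.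
  rewrite expr1 mulN1r; apply: ge0_norm_le.
    rewrite divr_ge0 ?(ltW y0)// subr_ge0; apply: ipsum_nd => //.
    by rewrite (leq_trans (leq_subr _ _))// leq_addr.
  rewrite ler_pdivrMr//.
  have := @ipsum_subadd R 2^-1 (lexx _) 1 (N - m.+1) m.+1; rewrite subnK//.
  have := @ipsum_subadd R 2^-1 (lexx _) 1 N m.+1.
  by have := half_harmonic_le_nat m.+1; rewrite -/y; lra.
have S2 : `|h 2 (N + m.+1) + (-1) ^+ 2 * h 2 (N - m.+1)| <= K2 + K2.
  by rewrite sqrrN expr1n mul1r; apply: normD_le; apply: ge0_norm_le.
have S3 : `|h 3 (N + m.+1) + (-1) ^+ 3 * h 3 (N - m.+1)| <= K3 + K3.
  rewrite (_ : (-1) ^+ 3 = -1 :> R) ?mulN1r; last by ring.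
  by apply: normB_le; apply: ge0_norm_le.
rewrite /int_term -/y -/Q -/Q' /=.
move: (h 1 (N + _) + _) (h 2 (N + _) + _) (h 3 (N + _) + _) (L + H 1 N - _ + _) A S1 S2 S3.
move=> s1 s2 s3 a A S1 S2 S3.
have yq : y ^+ q != 0 by rewrite expf_neq0// gt_eqF.
have -> : a * (Q * y ^- q.+1 * s1 + y ^- q * s2) -
    (Q' * y ^- q.+2 * s1 + Q * y ^- q.+1 * s2 + y ^- q * s3) +
    (Q * y ^- q.+2 * s1 + y ^- q.+1 * s2)
  = (a * (Q * (s1 / y) + s2) - (Q' * y^-1 * (s1 / y) + Q * y^-1 * s2 + s3)
    + (Q * y^-1 * (s1 / y) + y^-1 * s2)) * y ^- q.
  by rewrite !exprS; field; rewrite yq gt_eqF.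
have QN : `|Q| <= Q by exact: ge0_norm_le.
have Q'N : `|Q'| <= Q' by exact: ge0_norm_le.
apply: (@le_trans _ _ (((`|L| + 2) * h 1 m.+1 * (Q * 4 + (K2 + K2)) + D) * y ^- q)).
  apply: normM_le; last by apply: ge0_norm_le => //; rewrite invr_ge0 exprn_ge0// ltW.
  rewrite /D [X in _ <= X]addrA; apply: normD_le.
    apply: normB_le; first by apply: normM_le => //; apply: normD_le => //; exact: normM_le.
    by apply: normD_le => //; apply: normD_le; apply: normM_le => //; exact: normM_le.
  by apply: normD_le; apply: normM_le => //; exact: normM_le.
apply: (@le_trans _ _ (((`|L| + 2) * (Q * 4 + (K2 + K2)) + D) * (y ^- q * h 1 m.+1))).
  rewrite [X in _ <= X]mulrCA [X in _ <= X]mulrC; apply: ler_wpM2r.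
    by rewrite invr_ge0 exprn_ge0// ltW.
  rewrite [X in _ <= X]mulrDl; apply: lerD; first by rewrite mulrAC.
  by apply: ler_peMr => //; apply: le_trans h1; rewrite ler1n.
rewrite -[X in _ <= X]mulrA; apply: ler_wpM2l.
  by rewrite addr_ge0// !mulr_ge0// ?addr_ge0// mulr_ge0.
by have := @pow_le_major R 0 (half_ge0 R) q m q_gt1; rewrite subr0.
Qed.

End term_limits.

(** * Limit of the finite identity *)

Section reindexing.
Variable V : zmodType.

Lemma sum_nat_eqn_addl (f : nat -> V) a n M :
  \sum_(1 <= k < M | (a + k == n)%N) f k = if (a < n < a + M)%N then f (n - a)%N else 0.
Proof.
case: ifPn => [/andP[an nM]|/negP na].
  rewrite big_mkcond (bigD1_seq (n - a)%N) ?iota_uniq ?mem_index_iota//=; last by lia.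
  rewrite subnKC ?(ltnW an)// eqxx big1 ?addr0// => k /eqP kn.
  by case: eqP => // E; case: kn; lia.
by rewrite big_nat_cond big1// => k /andP[k1 /eqP kn]; case: na; lia.
Qed.

(** With [k] = [k2 + k3] and [j] = [k2 - 1], the triple sum takes the two-index shape required by
    [sum_even_pairs]. *)
Lemma sum_nat_convolution (f : nat -> nat -> V) a n M : (n < M)%N ->
  \sum_(1 <= k2 < M) \sum_(1 <= k3 < M | (a + k2 + k3 == n)%N) f k2 k3 =
  \sum_(1 <= k < M | (a + k == n)%N) \sum_(j < k.-1) f j.+1 (k.-1 - j)%N.
Proof.
move=> nM; rewrite sum_nat_eqn_addl.
under eq_bigr do rewrite sum_nat_eqn_addl.
rewrite -big_mkcond /=; case: ifPn => [/andP[an _]|na]; last first.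
  by rewrite big_nat_cond big1// => k; lia.
transitivity (\sum_(1 <= k < n - a) f k (n - a - k)%N).
  rewrite [RHS](big_nat_widen _ _ M) /=; last by lia.
  rewrite big_nat_cond [RHS]big_nat_cond; apply: eq_big => [k|k _]; first by lia.
  by rewrite subnDA.
rewrite -(big_mkord xpredT (fun j => f j.+1 ((n - a).-1 - j)%N)) big_add1 /=.
by apply: eq_bigr => j _; congr (f _ _); lia.
Qed.

End reindexing.

Section even_sums.
Variable R : pzRingType.

(** The factor [1 + (-1) ^+ a] is 2 at even [a] and 0 at odd [a]; it encodes the restriction to the
    arguments [2 * k1]. *)
Lemma sum_even (f : nat -> R) M :
  \sum_(1 <= a < M.*2.+1) (1 + (-1) ^+ a) * f a = 2 * \sum_(1 <= k < M.+1) f (2 * k)%N.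
Proof.
elim: M => [|M IH]; first by rewrite !big_geq ?mulr0.
rewrite doubleS big_nat_recr//= big_nat_recr//= IH [in RHS]big_nat_recr//= mulrDr.
rewrite -[in LHS]addrA; congr (_ + _).
have e1 : (-1) ^+ M.*2.+1 = -1 :> R by rewrite -signr_odd /= odd_double.
have e2 : (-1) ^+ M.*2.+2 = 1 :> R by rewrite -signr_odd /= odd_double.
by rewrite e1 e2 subrr mul0r add0r mul2n doubleS.
Qed.

Lemma sum_even_lt (g : nat -> R) n M : (n <= M)%N ->
  2 * (\sum_(1 <= k < M.+1 | (2 * k < n)%N) g (2 * k)%N) =
  \sum_(1 <= a < n) (1 + (-1) ^+ a) * g a.
Proof.
move=> nM; rewrite big_mkcond /= -(sum_even (fun a => if (a < n)%N then g a else 0)).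
rewrite (big_nat_widen _ n M.*2.+1); last by lia.
rewrite [RHS]big_mkcond; apply: eq_bigr => a _.
by case: ifP => //; rewrite mulr0.
Qed.

Lemma sum_even_pairs (G : nat -> nat -> R) n M : (n < M)%N ->
  2 * (\sum_(1 <= k1 < M) \sum_(1 <= k2 < M | (2 * k1 + k2 == n)%N) G (2 * k1)%N k2) =
  \sum_(1 <= k < n) (1 + (-1) ^+ (n - k)) * G (n - k)%N k.
Proof.
case: M => // M nM.
under eq_bigr do rewrite sum_nat_eqn_addl.
rewrite -big_mkcond /= [RHS]big_nat_rev /=.
transitivity (\sum_(1 <= a < n) (1 + (-1) ^+ a) * G a (n - a)%N); last first.
  apply: eq_big_nat => a /andP[a1 an]; have -> : (1 + n - a.+1 = n - a)%N by lia.
  by rewrite subKn// ltnW.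
rewrite -(@sum_even_lt (fun a => G a (n - a)%N) n M nM); congr (_ * _).
by apply: eq_bigl => k; lia.
Qed.

End even_sums.

Section limit_identity.
Variables (R : realType) (q : nat).
Hypothesis q_gt1 : (1 < q)%N.
Local Open Scope classical_set_scope.

Local Notation h := (@ipsum R 2^-1).
Local Notation H := (@ipsum R 0).
Local Notation L := (2 * ln 2 : R).

Lemma mharm2E (c : R) p r :
  mharm c [:: p; r] = fun N => \sum_(1 <= n < N) (n%:R - c) ^- p * ipsum c r n.-1.
Proof.
apply/funext => N.
transitivity (\sum_(1 <= n < N) (n%:R - c) ^- p * mharm c [:: r] n); first by [].
by apply: eq_big_nat => -[|n]// _; rewrite mharm1S.
Qed.

Lemma cvg_mharm2 (c : R) p r : c <= 2^-1 -> (1 < p)%N ->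
  (exists K, forall n, ipsum c r n <= K * h 1 n.+1) ->
  mharm c [:: p; r] @ \oo --> limn (mharm c [:: p; r]).
Proof.
move=> c_le p1 [K hK].
rewrite mharm2E.
have K0 : 0 <= K.
  have := hK 0%N; rewrite ipsum0; have := half_harmonic_ge2 R 0; nra.
apply: (@cvg_sum_major _ (K * 2 ^+ p)) => n /=.
have x0 : 0 <= (n.+1%:R - c) ^- p.
  rewrite invr_ge0 exprn_ge0// (le_trans (ltW (half_int_gt0 R n)))//.
  by rewrite lerD2l lerN2.
rewrite ger0_norm ?mulr_ge0 ?ipsum_ge0//.
apply: le_trans (_ : K * ((n.+1%:R - c) ^- p * h 1 n.+1) <= _).
  by rewrite mulrCA; apply: ler_wpM2l.
by rewrite -mulrA; apply: ler_wpM2l => //; exact: pow_le_major.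
Qed.

Lemma mtt2E : mtt [:: 2%N] = pi ^+ 2 / 2 :> R.
Proof.
have <- := cvg_lim (@Rhausdorff R) (@cvg_half_sum2 R).
by apply/esym/cvg_lim => //; exact: cvg_ipsum.
Qed.

Let h1_le1 (c : R) : c <= 2^-1 -> exists K, forall n, ipsum c 1 n <= K * h 1 n.+1.
Proof.
move=> c_le; exists 1 => n; rewrite mul1r (le_trans (ipsum_le_half c_le _ _))//.
exact: ipsum_nd.
Qed.

Let h2_le1 : exists K, forall n, h 2 n <= K * h 1 n.+1.
Proof.
have [K K0 hK] := @ipsum_bounded R 2^-1 (lexx _) 2 isT.
exists K => n; apply: le_trans (hK n) _; rewrite ler_peMr//.
by apply: le_trans (half_harmonic_ge2 R n); rewrite ler1n.
Qed.

Let cvg_T12 :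
  (fun N => \sum_(1 <= n < N) (hodd 1 n.-1 * hodd 2 n.-1 / (n%:R - 2^-1) ^+ q))
    @ \oo --> (T12 q : R).
Proof.
have [K K0 hK] := @ipsum_bounded R 2^-1 (lexx _) 2 isT.
apply: (@cvg_sum_major _ (K * 2 ^+ q)) => n /=.
have hE p : hodd p n = h p n by [].
rewrite !hE.
have x0 : 0 <= (n.+1%:R - 2^-1 : R) ^- q.
  by rewrite invr_ge0 exprn_ge0// ltW// half_int_gt0.
rewrite ger0_norm ?mulr_ge0 ?ipsum_ge0//.
apply: le_trans (_ : K * ((n.+1%:R - 2^-1) ^- q * h 1 n.+1) <= _).
  rewrite mulrAC mulrC; apply: ler_pM; rewrite ?mulr_ge0 ?ipsum_ge0 ?hK//.
  by rewrite mulrC; apply: ler_wpM2l => //; exact: ipsum_nd.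
by rewrite -mulrA; apply: ler_wpM2l => //; exact: pow_le_major.
Qed.

(** Writing [h p n] as [h p n.-1] plus its last term makes every inner sum stop at [n.-1];
    multiplying out then gives strictly nested sums. *)
Lemma lim_half_lim :
  limn (fun N => \sum_(1 <= n < N) half_lim R q n) =
    (1 - (-1) ^+ q) * T12 q + (1 + (-1) ^+ q) * mtt [:: 2%N] * mtt [:: q; 1%N]
    + mtt [:: 2%N] * mtt [:: q.+1] + mtt [:: q.+2; 1%N] + mtt [:: q.+1; 2%N]
    + mtt [:: q.+3].
Proof.
apply: cvg_lim => //; rewrite mtt2E.
pose T N : R := \sum_(1 <= n < N) (hodd 1 n.-1 * hodd 2 n.-1 / (n%:R - 2^-1) ^+ q).
pose t s N : R := mharm 2^-1 s N.
have c0 : T @ \oo --> (T12 q : R) by exact: cvg_T12.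
have c1 : t [:: q; 1%N] @ \oo --> mtt [:: q; 1%N].
  by apply: cvg_mharm2 => //; exact/h1_le1.
have c2 : t [:: q.+2; 1%N] @ \oo --> mtt [:: q.+2; 1%N].
  by apply: cvg_mharm2 => //; exact/h1_le1.
have c3 : t [:: q.+1; 2%N] @ \oo --> mtt [:: q.+1; 2%N].
  by apply: cvg_mharm2 => //; rewrite ltnS ltnW.
have ct p : (1 < p)%N -> t [:: p] @ \oo --> mtt [:: p].
  move=> p1; rewrite -cvg_shiftS.
  apply: cvg_trans (cvg_ipsum (lexx _) p1); apply: near_eq_cvg.
  by near=> N; rewrite -mharm1S.
have c4 := ct q.+1 (ltnW q_gt1); have c5 := ct q.+3 isT.
rewrite (_ : (fun N => _) = fun N => (1 - (-1) ^+ q) * T N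
    + (1 + (-1) ^+ q) * (pi ^+ 2 / 2) * t [:: q; 1%N] N
    + pi ^+ 2 / 2 * t [:: q.+1] N + t [:: q.+2; 1%N] N + t [:: q.+1; 2%N] N + t [:: q.+3] N).
  by cvg_arith.
apply/funext => N; rewrite /T /t !mharm2E !mharm1E !mulr_sumr -!big_split /=.
apply: eq_big_nat => -[|n]// _.
have hE p : hodd p n = h p n by [].
rewrite /half_lim /= !hE; move: (pi ^+ 2 / 2) => z; rewrite !ipsumS expr1 !exprS.
have := half_int_gt0 R n; move: (n.+1%:R - 2^-1) => x x0.
have xq : x ^+ q != 0 by rewrite expf_neq0// gt_eqF.
by field; rewrite xq gt_eqF.
Unshelve. all: by end_near. Qed.

Lemma lim_int_lim :
  limn (fun N => \sum_(1 <= m < N) int_lim R q m) =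
    pi ^+ 2 * (mzeta [:: q; 1%N] + L * mzeta [:: q]) - (q%:R - 1) * pi ^+ 2 * mzeta [:: q.+1].
Proof.
apply: cvg_lim => //.
pose t s N : R := mharm 0 s N.
have c1 : t [:: q; 1%N] @ \oo --> mzeta [:: q; 1%N].
  by apply: cvg_mharm2 => //; exact/h1_le1.
have ct p : (1 < p)%N -> t [:: p] @ \oo --> mzeta [:: p].
  move=> p1; rewrite -cvg_shiftS.
  apply: cvg_trans (cvg_ipsum (half_ge0 R) p1); apply: near_eq_cvg.
  by near=> N; rewrite -mharm1S.
have c4 := ct q.+1 (ltnW q_gt1); have c5 := ct q q_gt1.
rewrite (_ : (fun N => _) = fun N => pi ^+ 2 * (t [:: q; 1%N] N + L * t [:: q] N)
  - (q%:R - 1) * pi ^+ 2 * t [:: q.+1] N).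
  by cvg_arith.
apply/funext => N; rewrite /t !mharm2E !mharm1E !mulr_sumr -!big_split /= !mulr_sumr -sumrB.
apply: eq_big_nat => -[|n]// _.
rewrite /int_lim /= subr0 mulrCA mulfV// mulr1.
by ring.
Unshelve. all: by end_near. Qed.

Definition coef12_lim i : R := L * (i.+1%:R * mzeta [:: i.+2])
  - \sum_(j < i) mzeta [:: j.+2] * ((i - j)%:R * mzeta [:: (i - j).+1]).

Definition coef1_lim i : R := if i is 0 then L else - mzeta [:: i.+1].

Lemma limit_identity :
  (1 - (-1) ^+ q) * T12 q + (1 + (-1) ^+ q) * mtt [:: 2%N] * mtt [:: q; 1%N]
    + mtt [:: 2%N] * mtt [:: q.+1] + mtt [:: q.+2; 1%N] + mtt [:: q.+1; 2%N]
    + mtt [:: q.+3] =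
  \sum_(i < q) coef12_lim i * ((1 + (-1) ^+ (q - i)) * mtt [:: (q - i)%N])
  + \sum_(i < q.+2) coef1_lim i * ((1 + (-1) ^+ (q.+2 - i)) * mtt [:: (q.+2 - i)%N])
  + \sum_(i < q.+1) (i.+1%:R * mzeta [:: i.+2])
      * ((1 + (-1) ^+ (q.+1 - i)) * mtt [:: (q.+1 - i)%N])
  + (1 + (-1) ^+ q.+3) * mtt [:: q.+3]
  + (pi ^+ 2 * (mzeta [:: q; 1%N] + L * mzeta [:: q])
     - (q%:R - 1) * pi ^+ 2 * mzeta [:: q.+1]).
Proof.
rewrite -lim_half_lim -lim_int_lim.
have [C1 hC1] := half_term_bound R q_gt1; have [C2 hC2] := int_term_bound R q_gt1.
have [_ c1] := tannery_major (@cvg_half_term R q) hC1.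
have [_ c2] := tannery_major (@cvg_int_term R q) hC2.
have <- := cvg_lim (@Rhausdorff R) c1.
apply: cvg_lim => //.
have cz p : (1 < p)%N -> H p N @[N --> \oo] --> mzeta [:: p] by exact: cvg_ipsum.
(* For [j = 1] the sum diverges and [mtt [:: 1]] is a default value, but both are multiplied by
   0. *)
have ct j : (0 < j)%N -> (1 + (-1) ^+ j) * h j N @[N --> \oo] --> (1 + (-1) ^+ j) * mtt [:: j].
  case: j => [|[|j]]// _; last by apply: cvgM; [exact: cvg_cst|exact: cvg_ipsum].
  by rewrite expr1 subrr mul0r; under eq_fun do rewrite mul0r; exact: cvg_cst.
rewrite (funext (finite_identity L q)).
apply: cvgD; last exact: c2.
apply: cvgD; last exact: ct.
apply: cvgD; first apply: cvgD; apply: cvg_sum_seq => -[i /= iq].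
- apply: cvgM; last by apply: ct; rewrite subn_gt0.
  rewrite /coef12 /coef12_lim; apply: cvgB.
    by apply: cvgM; [exact: cvg_cst|apply: cvgM; [exact: cvg_cst|exact: cz]].
  apply: cvg_sum_seq => -[j /= ji]; apply: cvgM; first exact: cz.
  by apply: cvgM; [exact: cvg_cst|apply: cz; rewrite ltnS subn_gt0].
- apply: cvgM; last by apply: ct; rewrite subn_gt0.
  case: i iq => [|i] iq /=; first exact: cvg_cst.
  by apply: cvgN; exact: cz.
- apply: cvgM; last by apply: ct; rewrite subn_gt0.
  by apply: cvgM; [exact: cvg_cst|exact: cz].
Qed.

End limit_identity.

(** * Matching the limit with the stated sums *)

Theorem theorem2p6 (R : realType) (q : nat) (hq : (1 < q)%N) :
  (1 - (-1) ^+ q) * T12 q =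
    pi ^+ 2 * (mzeta [:: q; 1%N] + 2 * ln 2 * mzeta [:: q])
    - (q%:R - 1) * pi ^+ 2 * mzeta [:: (q + 1)%N]
    + ((-1) ^+ (q + 1) - 1) * mtt [:: 2%N] * mtt [:: q; 1%N]
    - mtt [:: 2%N] * mtt [:: (q + 1)%N]
    - mtt [:: (q + 2)%N; 1%N]
    - mtt [:: (q + 1)%N; 2%N]
    - (-1) ^+ q * mtt [:: (q + 3)%N]
    + 2 * (1 + (-1) ^+ q) * ln 2 * mtt [:: (q + 2)%N]
    + 2 * (\sum_(1 <= k1 < q.+3)
             \sum_(1 <= k2 < q.+3 | (2 * k1 + k2 == q + 2)%N)
               (k2%:R - 1) * mtt [:: (2 * k1)%N] * mzeta [:: (k2 + 1)%N])
    + 4 * ln 2 * (\sum_(1 <= k1 < q.+2)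
             \sum_(1 <= k2 < q.+2 | (2 * k1 + k2 == q + 1)%N)
               k2%:R * mtt [:: (2 * k1)%N] * mzeta [:: (k2 + 1)%N])
    - 2 * (\sum_(1 <= k1 < q.+2) \sum_(1 <= k2 < q.+2)
             \sum_(1 <= k3 < q.+2 | (2 * k1 + k2 + k3 == q + 1)%N)
               k3%:R * mtt [:: (2 * k1)%N] * mzeta [:: (k2 + 1)%N]
                     * mzeta [:: (k3 + 1)%N])
    :> R.
Proof.
rewrite !addn1 !addn2 !addn3.
pose E k : R := (1 + (-1) ^+ k) * mtt [:: k].
have reidx (n : nat) (F : nat -> R) : \sum_(1 <= k < n.+1) F k = \sum_(i < n) F i.+1.
  by rewrite big_add1 big_mkord.
set S1 := \sum_(1 <= k1 < q.+3) _; set S2 := \sum_(1 <= k1 < q.+2) _.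
set S3 := \sum_(1 <= k1 < q.+2) _.
have S1E : 2 * S1 = \sum_(i < q.+1) i%:R * mzeta [:: i.+2] * E (q.+1 - i)%N.
  rewrite /S1 (sum_even_pairs (fun a k => (k%:R - 1) * mtt [:: a] * mzeta [:: (k + 1)%N]))//.
  rewrite reidx; apply: eq_bigr => i _; rewrite subSS /E addn1 -natr1.
  by ring.
have S2E : 2 * S2 = \sum_(i < q) i.+1%:R * mzeta [:: i.+2] * E (q - i)%N.
  rewrite /S2 (sum_even_pairs (fun a k => k%:R * mtt [:: a] * mzeta [:: (k + 1)%N]))//.
  rewrite reidx; apply: eq_bigr => i _; rewrite subSS /E addn1.
  by ring.
have S3E : 2 * S3 = \sum_(i < q)
    (\sum_(j < i) mzeta [:: j.+2] * ((i - j)%:R * mzeta [:: (i - j).+1])) * E (q - i)%N.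
  rewrite /S3.
  under eq_bigr do rewrite sum_nat_convolution//.
  rewrite (sum_even_pairs (fun a k => \sum_(j < k.-1)
     ((k.-1 - j)%:R * mtt [:: a] * mzeta [:: (j.+1 + 1)%N] * mzeta [:: (k.-1 - j + 1)%N])))//.
  rewrite reidx; apply: eq_bigr => i _; rewrite subSS /E /= mulr_sumr mulr_suml.
  by apply: eq_bigr => j _; rewrite !addn1; ring.
have := limit_identity R hq.
have -> : \sum_(i < q) coef12_lim R i * ((1 + (-1) ^+ (q - i)) * mtt [:: (q - i)%N])
    = 2 * ln 2 * (2 * S2) - 2 * S3.
  rewrite S2E S3E mulr_sumr -sumrB; apply: eq_bigr => i _.
  by rewrite /coef12_lim /E; ring.
(* The term [i = 0] of [coef1_lim] gives the log 2 multiple of t(q+2). The others, of weight -1,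
   lower the weights [i.+1] of the third sum to the weights [i] = [k2 - 1] of [S1]. *)
rewrite big_ord_recl /= subn0.
have -> : \sum_(i < q.+1) (- mzeta [:: (bump 0 i).+1]) *
    ((1 + (-1) ^+ (q.+2 - bump 0 i)) * mtt [:: (q.+2 - bump 0 i)%N]) =
    2 * S1 - \sum_(i < q.+1) (i.+1%:R * mzeta [:: i.+2]) * 
      ((1 + (-1) ^+ (q.+1 - i)) * mtt [:: (q.+1 - i)%N]).
  rewrite S1E -sumrB; apply: eq_bigr => i _.
  by rewrite /bump /= add1n subSS /E -[i.+1%:R]natr1; ring.
(* The two occurrences of t(q+3) combine to the coefficient (1 - (-1)^q) - 1 = -(-1)^q. *)
rewrite !exprS => lim_id.
apply/eqP; rewrite -subr_eq0.
move/eqP: lim_id; rewrite -subr_eq0 => /eqP lim_id; apply/eqP; rewrite -[RHS]lim_id.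
by ring.
Qed.
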